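(* Let $P$ and $P'$ be the original and the observed point clouds in $\mathbb{R}^d$, respectively, and let persistence diagrams be computed with the Rips filtration. Then for every integer $N$ with $0\le N\le n-2$, $$d_B\big(\bar{\mathrm D}_N(P),\bar{\mathrm D}_N(P')\big)=\begin{cases}\dfrac{\sqrt{2\nu d}}{4}+O_{\mathbb P}(1), & N=0,\\[1ex] O_{\mathbb P}(1), & N>0,\end{cases}$$ holds as $d\to\infty$. Moreover, suppose that the $N$-th persistence diagram $\mathrm D_N(P)$ is non-empty. Then $d_B(\bar{\mathrm D}_N(P),\bar{\mathrm D}_N(P'))$ does not converge to zero in probability as $d\to\infty$, and $d_H(\mathrm D_N(P),\mathrm D_N(P'))$ is eventually unbounded in probability as $d\to\infty$.
   Context: Setting. Fix integers $n>3$ and $1\le s<n$ and let $d>n$ tend to infinity ($n,s$ do not depend on $d$). The original point cloud is $P=\{x_1,\dots,x_n\}\subset\mathbb{R}^d$ with $x_i=(x_{1i},\dots,x_{si},0,\dots,0)^T$, where the numbers $x_{ki}$ are fixed and do not depend on $d$. The noise point cloud is $E=\{e_1,\dots,e_n\}\subset\mathbb{R}^d$, where $e_1,\dots,e_n$ are i.i.d. random vectors following a continuous distribution (absolutely continuous with respect to Lebesgue measure) with mean zero and covariance matrix $\nu I_d$, $\nu>0$, and the coordinates of every $e_i$ are i.i.d. as well (with a law not depending on $d$). The observed point cloud is $P'=\{x_1',\dots,x_n'\}$, $x_i'=x_i+e_i$. Persistence diagrams. For a finite point cloud $X\subset\mathbb{R}^d$ and $r\ge0$, the Rips complex at parameter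 $r$ is the set of $\sigma\subseteq X$ such that $B_x(r)\cap B_y(r)\ne\emptyset$ for all $x,y\in\sigma$ (closed Euclidean balls of radius $r$, i.e. $\|x-y\|\le 2r$). $\mathrm D_N(X)$ is the $N$-th persistence diagram of this filtration using reduced homology with coefficients in a fixed field: the multiset of (birth, death) pairs, with birth < death, in $\mathbb{R}_{\ge0}^2$. $\bar{\mathrm D}_N(X)$ is the disjoint union of $\mathrm D_N(X)$ and all points of the diagonal $\{(x,x):x\ge0\}$, each with infinite multiplicity. Distances. $d_B(\bar{\mathrm D}_N(X),\bar{\mathrm D}_N(Y))=\inf_\eta\sup_x\|x-\eta(x)\|_\infty$ over all bijections $\eta:\bar{\mathrm D}_N(X)\to\bar{\mathrm D}_N(Y)$. $d_H(A,B)$ is the Hausdorff distance in $\mathbb{R}_{\ge0}^2$ with the metric of $\|\cdot\|_\infty$, with $d_H(A,\emptyset)=d_H(\emptyset,A)=+\infty$ for $A\neq\emptyset$ and $d_H(\emptyset,\emptyset)=0$. Asymptotic notation. A sequence $X_d$ of random variables is eventually bounded in probability, $X_d=O_{\mathbb P}(1)$, if for every $\varepsilon>0$ there are a constant $C$ and an integer $M$ with $\mathbb P(|X_d|\le C)\ge1-\varepsilon$ for all $d>M$; it is eventually unbounded in probability if it is not eventually bounded in probability. $X_d=f(d)+O_{\mathbb P}(1)$ means $X_d-f(d)=O_{\mathbb P}(1)$.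
   Formalization: For N = 0 the rate √(2νd)/4 + O_P(1) is proved assuming the noise coordinates have a finite fourth moment; without it the claim fails (e.g. Student-t noise with 3 degrees of freedom gives an error of order d^{1/6}). *)

(* Defs.v *)
From HB Require Import structures.
From mathcomp Require Import all_boot all_order all_algebra.
From mathcomp Require Import finmap.
From mathcomp Require Import all_classical all_reals all_analysis.

Set Implicit Arguments.
Unset Strict Implicit.
Unset Printing Implicit Defensive.

Import Order.TTheory GRing.Theory Num.Theory.
Import numFieldNormedType.Exports.

Local Open Scope classical_set_scope.
Local Open Scope ring_scope.

(** * Reduced simplicial homology

    A simplicial complex on a finite vertex type [V] is a downward closed set
    of subsets of [V]; it contains the empty simplex, which has dimension -1
    and makes the chain complex below the augmented one. *)

Section Homology.
Variables (F : fieldType) (V : finType).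

Definition chain := {ffun {set V} -> F^o}.

Definition elementary_chain (sigma : {set V}) : chain :=
  [ffun tau => (tau == sigma)%:R].

(* Simplices are oriented by the enumeration of [V]: in the boundary of
   [v |: tau] the face [tau] has sign (-1)^(position of v in v |: tau). *)
Definition face_sign (tau : {set V}) (v : V) : F :=
  (-1) ^+ #|[set w in tau | (enum_rank w < enum_rank v)%N]|.

Definition boundary (c : chain) : chain :=
  [ffun tau : {set V} =>
    \sum_(v | v \notin tau) (face_sign tau v * c (v |: tau)%SET : F^o)].

Fact boundary_is_linear : linear boundary.
Proof.
move=> a c c'; apply/ffunP => tau; rewrite !ffunE /GRing.scale /= mulr_sumr.
rewrite -big_split /=; apply: eq_bigr => v _.
by rewrite !ffunE /GRing.scale /= mulrDr mulrCA.
Qed.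

HB.instance Definition _ :=
  GRing.isLinear.Build F chain chain *:%R boundary boundary_is_linear.

Definition chains (N : nat) (K : {set {set V}}) : {vspace chain} :=
  <<[seq elementary_chain sigma | sigma in [set s in K | #|s| == N.+1]]>>%VS.

Definition cycles (N : nat) (K : {set {set V}}) : {vspace chain} :=
  (chains N K :&: lker (linfun boundary))%VS.

Definition boundaries (N : nat) (K : {set {set V}}) : {vspace chain} :=
  (linfun boundary @: chains N.+1 K)%VS.

(* For K a subcomplex of L, the rank of H_N(K) -> H_N(L), whose image is
   (Z_N(K) + B_N(L)) / B_N(L). *)
Definition persistent_betti (N : nat) (K L : {set {set V}}) : nat :=
  \dim (cycles N K + boundaries N L)%VS - \dim (boundaries N L).

End Homology.

(** * Persistence diagrams

    The [N]-th diagram of a filtration is the multiset of points of the plane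
    given by its multiplicity function. *)

Section Persistence.
Variables (R : realType) (F : fieldType) (V : finType).
Variable K : R -> {set {set V}}.

Definition before (r : R) : {set {set V}} :=
  [set sigma : {set V} | `[< exists2 q, q < r & sigma \in K q >]]%SET.

(* The number of classes born at b and dying at d: among the classes alive
   just before d and dead at d, those born by b but not before b.  For a
   right-continuous filtration all differences are nonnegative. *)
Definition multiplicity (N : nat) (p : R * R) : nat :=
  let: (b, d) := p in
  if b < d then
    ((persistent_betti F N (K b) (before d) -
      persistent_betti F N (K b) (K d)) -
     (persistent_betti F N (before b) (before d) -
      persistent_betti F N (before b) (K d)))%N
  else 0%N.

End Persistence.

Section Rips.
Variables (R : realType) (d : nat).

Definition enorm (u : 'rV[R]_d) : R := Num.sqrt (\sum_(k < d) u 0 k ^+ 2).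

Definition rips (X : {fset 'rV[R]_d}) (r : R) : {set {set X}} :=
  [set sigma : {set X} |
    [forall x in sigma, forall y in sigma, enorm (val x - val y) <= 2 * r]]%SET.

(* [rips X r] has no vertex for r < 0, so every birth is nonnegative. *)
Definition rips_diagram (F : fieldType) (N : nat) (X : {fset 'rV[R]_d}) :
  R * R -> nat := multiplicity F (rips X) N.

End Rips.

(** * Distances between diagrams

    The norm of [R * R] in the library is the maximum norm. *)

Section Distances.
Variable R : realType.

Definition support_set (D : R * R -> nat) : set (R * R) :=
  [set p | (0 < D p)%N].

(* The copies (p, 0), ..., (p, D p - 1) of every off-diagonal point p, and
   the copies (p, k), k : nat, of every point p of the diagonal. *)
Definition extended (D : R * R -> nat) : set ((R * R) * nat) :=
  [set a | (a.2 < D a.1)%N \/ (0 <= a.1.1 /\ a.1.1 = a.1.2)].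

Local Open Scope ereal_scope.

Definition bottleneck (D D' : R * R -> nat) : \bar R :=
  ereal_inf [set ereal_sup [set `|a.1 - (eta a).1|%:E | a in extended D]
            | eta in [set eta | set_bij (extended D) (extended D') eta]].

Definition directed_hausdorff (A B : set (R * R)) : \bar R :=
  ereal_sup [set ereal_inf [set `|a - b|%:E | b in B] | a in A].

(* The maximum with 0 matters only if A and B are both empty, as the supremum
   of the empty set is -oo. *)
Definition hausdorff (A B : set (R * R)) : \bar R :=
  maxe 0 (maxe (directed_hausdorff A B) (directed_hausdorff B A)).

End Distances.

(** * Asymptotics in probability

    Sequences [X] of extended real functions on probability spaces [T d].
    Probabilities are inner and outer ones, so that they make sense before
    [X d] is known to be measurable; both agree with [P] on measurable
    events. *)

Section Asymptotics.
Local Open Scope ereal_scope.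
Local Open Scope measure_scope.

Definition outer_prob d (T : measurableType d) (R : realType)
  (P : probability T R) (A : set T) : \bar R := P^* A.

Definition inner_prob d (T : measurableType d) (R : realType)
  (P : probability T R) (A : set T) : \bar R := 1 - outer_prob P (~` A).

Lemma outer_probE d (T : measurableType d) (R : realType)
  (P : probability T R) (A : set T) : measurable A -> outer_prob P A = P A.
Proof. exact: measurable_mu_extE. Qed.

Lemma inner_probE d (T : measurableType d) (R : realType)
  (P : probability T R) (A : set T) : measurable A -> inner_prob P A = P A.
Proof.
move=> mA; rewrite /inner_prob outer_probE; last exact: measurableC.
by rewrite -probability_setC ?setCK//; exact: measurableC.
Qed.

Variables (R : realType) (disp : nat -> measure_display).
Variables (T : forall d, measurableType (disp d)).
Variables (P : forall d, probability (T d) R) (X : forall d, T d -> \bar R).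

Definition bounded_in_prob : Prop :=
  forall eps : R, (0 < eps)%R -> exists (C : R) (M : nat),
    forall d, (M < d)%N ->
      (1 - eps)%:E <= inner_prob (P d) [set w | `|@X d w| <= C%:E].

Definition unbounded_in_prob : Prop := ~ bounded_in_prob.

Definition cvg_to_zero_in_prob : Prop :=
  forall eps : R, (0 < eps)%R ->
    outer_prob (P d) [set w | eps%:E < `|@X d w|] @[d --> \oo] --> (0 : \bar R).

End Asymptotics.

(** * Original and observed point clouds *)

Section Clouds.
Variables (R : realType) (n s : nat).

(* x_i = (x_{1i}, ..., x_{si}, 0, ..., 0). *)
Definition original_point (x : 'I_s -> 'I_n -> R) (d : nat) (i : 'I_n) :
  'rV[R]_d := \row_(k < d) oapp (fun k' : 'I_s => x k' i) 0 (insub (val k)).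

Definition observed_point (x : 'I_s -> 'I_n -> R) (d : nat)
    (e : 'I_n -> d.-tuple R) (i : 'I_n) : 'rV[R]_d :=
  original_point x d i + \row_(k < d) tnth (e i) k.

Definition cloud (d : nat) (pts : 'I_n -> 'rV[R]_d) : {fset 'rV[R]_d} :=
  [fset pts i | i : 'I_n]%fset.

Definition original_cloud x d := cloud (original_point x d).
Definition observed_cloud x d (e : 'I_n -> d.-tuple R) :=
  cloud (observed_point x e).

End Clouds.

(** * The noise *)

Section Noise.
Local Open Scope ereal_scope.

(* Mutual independence of a finite family of random variables; subfamilies
   are covered by taking A i = setT. *)
Definition independent_family (R : realType) dT (T : measurableType dT)
    (P : probability T R) dU (U : measurableType dU) (I : finType)
    (X : I -> T -> U) : Prop :=
  forall A : I -> set U, (forall i, measurable (A i)) ->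
    P (\bigcap_(i in setT) (X i @^-1` A i)) = \prod_(i : I) P (X i @^-1` A i).

(* e_1, ..., e_n are i.i.d. random vectors of R^d with mean zero and
   covariance matrix nu I_d, and the coordinates of each e_i are i.i.d. with
   law mu.  Sigma-algebra on R^d: generated by the coordinates. *)
Record noise_cloud (R : realType) (n d : nat) dT (T : measurableType dT)
    (P : probability T R) (mu : probability (measurableTypeR R) R) (nu : R)
    (e : 'I_n -> {RV P >-> d.-tuple (measurableTypeR R)}) : Prop := {
  noise_indep : independent_family P (fun i w => e i w);
  noise_ident : forall i j A, measurable A ->
    P (e i @^-1` A) = P (e j @^-1` A);
  noise_coord_indep : forall i,
    independent_family P (fun (k : 'I_d) w => tnth (e i w) k);
  noise_coord_law : forall i k A, measurable A ->
    P ((fun w => tnth (e i w) k) @^-1` A) = mu A;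
  noise_mean : forall i k, 'E_P[(fun w => tnth (e i w) k : R)] = 0;
  noise_cov : forall i k l,
    covariance P (fun w => tnth (e i w) k : R) (fun w => tnth (e i w) l : R) =
    (if k == l then nu%:E else 0)
}.

(* A d-fold product law is absolutely continuous on R^d exactly when its
   factor is absolutely continuous on R. *)
Definition continuous_law (R : realType)
    (mu : probability (measurableTypeR R) R) : Prop :=
  mu `<< (@lebesgue_measure R).

(* Mean and covariance alone do not give |e_i - e_j| = sqrt (2 nu d) + O_P(1):
   for Student's law with 3 degrees of freedom the error has order d^(1/6). *)
Definition finite_fourth_moment (R : realType)
    (mu : probability (measurableTypeR R) R) : Prop :=
  \int[mu]_y ((y : R) ^+ 4)%:E < +oo.

End Noise.

(* Main.v *)
From HB Require Import structures.
Require Import Defs.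
From mathcomp Require Import all_boot all_order all_algebra.
From mathcomp Require Import finmap.
From mathcomp Require Import all_classical all_reals all_analysis.
From mathcomp Require Import measurable_realfun.
From mathcomp Require Import ring lra zify.

(** All births and deaths of a Rips diagram are half distances of points of the
    cloud.  In the observed cloud Y the cross products <y_i, y_j> are O_P(sqrt d)
    while all |y_i|^2 are at least of order d; hence every death tends to
    infinity like sqrt d, whereas the points of D_N(P) stay in a fixed finite
    set.  This gives the two divergence statements.  For N > 0 the squared
    distances are |y_i|^2 + |y_j|^2 + O_P(sqrt d), so the Rips complexes are
    interleaved, at scale sqrt d for squared parameters, with clique complexes of
    threshold graphs, which are a cone together with isolated points and have no
    homology in positive degree; dividing by the deaths, all persistences are
    O_P(1).  For N = 0, finite fourth moments give |y_i - y_j| =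
    sqrt (2 nu d) + O_P(1), so that matching every point with the diagonal is
    optimal up to O_P(1). *)

Set Implicit Arguments.
Unset Strict Implicit.
Unset Printing Implicit Defensive.

Import Order.TTheory GRing.Theory Num.Theory.
Import numFieldNormedType.Exports.

Local Open Scope classical_set_scope.
Local Open Scope ring_scope.

(** * Homology of cones and edges *)

(** Without fourth moments the norms |y_i|^2 may fluctuate at a scale larger than sqrt d, and
    differently for each i. This is why positive degrees are compared with threshold graphs, which
    tolerate arbitrary norms, rather than with equidistant points. Mixed products of distinct noise
    vectors behave better: their second moments factor by independence and involve variances only.
    The constant 1/4 comes from a point of D_0(P') close to (0, S / 2), where S = sqrt(2 nu d): its
    distance to the diagonal is half its persistence, about S / 4, whereas the bounded points of
    D_0(P) are about S / 2 away. All randomness is confined to a few likely events about inner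
    products; everything deduced from them is deterministic. Probabilities are outer ones, monotone
    and subadditive on all sets, so that measurability of the distances is not an issue. *)

Section HomologyFacts.
Variables (F : fieldType) (V : finType).
Implicit Types (K L T : {set {set V}}) (sigma tau : {set V}) (v w : V).
Local Notation chain := (chain F V).

Lemma chainsP N K (c : chain) :
  reflect (forall sigma, c sigma != 0 -> sigma \in K /\ #|sigma| = N.+1)
          (c \in chains F N K).
Proof.
apply: (iffP idP) => [cNK sigma|cK].
  rewrite /chains in cNK.
  rewrite (coord_span (X := in_tuple _) cNK) sum_ffunE => /eqP.
  apply: contra_notP => nK; apply: big1 => i _.
  have : (in_tuple
    [seq elementary_chain F sigma0 | sigma0 in [set s in K | #|s| == N.+1]%SET])`_i
    \in [seq elementary_chain F sigma0 | sigma0 in [set s in K | #|s| == N.+1]%SET].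
    by apply: mem_nth; case: i.
  case/fintype.imageP=> tau; rewrite inE => /andP[tauK /eqP tauN] ->.
  rewrite !ffunE; case: eqP => [st|_]; last by rewrite scaler0.
  by case: nK; rewrite st.
have -> : c = \sum_(sigma : {set V}) c sigma *: elementary_chain F sigma.
  apply/ffunP => tau; rewrite sum_ffunE (bigD1 tau)//= !ffunE eqxx.
  rewrite big1 ?addr0 => [|sigma neq]; first by rewrite /GRing.scale/= mulr1.
  by rewrite !ffunE eq_sym (negPf neq) scaler0.
apply: rpred_sum => sigma _.
have [->|nz] := eqVneq (c sigma) 0; first by rewrite scale0r mem0v.
have [sK sN] := cK _ nz.
by apply/rpredZ/memv_span/fintype.imageP; exists sigma => //; rewrite inE sK sN eqxx.
Qed.

Lemma cyclesP N K (c : chain) :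
  reflect (c \in chains F N K /\ boundary c = 0) (c \in cycles F N K).
Proof.
rewrite memv_cap memv_ker lfunE; apply: (iffP andP) => -[-> /eqP].
  by [].
by [].
Qed.

Lemma boundariesP N K (c : chain) :
  reflect (exists2 b, b \in chains F N.+1 K & c = boundary b)
          (c \in boundaries F N K).
Proof.
apply: (iffP memv_imgP) => -[b bK ->]; exists b => //; first by rewrite lfunE.
by rewrite lfunE.
Qed.

Lemma chainsS N K L : {subset K <= L} -> (chains F N K <= chains F N L)%VS.
Proof.
move=> KL; apply/subvP => c /chainsP cK; apply/chainsP => sigma /cK[+ ->].
by move=> /KL.
Qed.

Lemma boundariesS N K L : {subset K <= L} ->
  (boundaries F N K <= boundaries F N L)%VS.
Proof. by move=> KL; apply/limgS/chainsS. Qed.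

Lemma persistent_betti_eq0 N K L :
  (cycles F N K <= boundaries F N L)%VS -> persistent_betti F N K L = 0%N.
Proof.
by move=> /addv_idPr ZB; rewrite /persistent_betti ZB subnn.
Qed.

Lemma face_signM tau v : face_sign F tau v * face_sign F tau v = 1.
Proof. by rewrite /face_sign -expr2 sqrr_sign. Qed.

Lemma face_signU tau v w : v \notin tau ->
  face_sign F (v |: tau)%SET w =
  (-1) ^+ (enum_rank v < enum_rank w)%N * face_sign F tau w.
Proof.
move=> vtau; rewrite /face_sign -exprD; congr (_ ^+ _).
have -> : [set u in (v |: tau)%SET | (enum_rank u < enum_rank w)%N]%SET =
    ((if (enum_rank v < enum_rank w)%N then [set v] else finset.set0) :|:
    [set u in tau | (enum_rank u < enum_rank w)%N])%SET.
  apply/setP => u; rewrite !inE; have [->|uv] := eqVneq u v.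
    by rewrite (negPf vtau)/=; case: ifP => //; rewrite !inE ?eqxx.
  by case: ifP; rewrite !inE ?(negPf uv).
case: ifP => _; last by rewrite finset.set0U.
by rewrite cardsU1 inE (negPf vtau).
Qed.

(** Exactly one of [v] and [w] precedes the other, so the two orders of insertion differ by one
    transposition. *)
Lemma face_sign_anticomm tau v w : v \notin tau -> w \notin tau -> v != w ->
  face_sign F (v |: tau)%SET w * face_sign F tau v =
  - (face_sign F (w |: tau)%SET v * face_sign F tau w).
Proof.
move=> vt wt vw; rewrite !face_signU//.
have : enum_rank v != enum_rank w :> nat.
  by apply: contra vw => /eqP/val_inj/enum_rank_inj ->.
by case: ltngtP => // _ _; rewrite expr0 expr1; ring.
Qed.

(** The join with [v], as a chain homotopy: simplices of [c] that already contain [v] contribute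
    nothing. *)
Definition cone v (c : chain) : chain :=
  [ffun sigma : {set V} => if v \in sigma then
     face_sign F (sigma :\ v)%SET v * c (sigma :\ v)%SET else 0].

(** The homotopy contracts the augmented complex of the full simplex to zero. On a simplex without
    [v] only the face obtained by deleting [v] survives; on a simplex with [v] all other terms
    cancel in pairs by anticommutation of the signs. *)
Lemma boundary_cone v (c : chain) :
  boundary (cone v c) + cone v (boundary c) = c.
Proof.
apply/ffunP => tau; rewrite !ffunE; case: ifPn => vtau; last first.
  rewrite addr0 (bigD1 v)//= !ffunE setU11 setU1K// mulrA face_signM mul1r.
  rewrite big1 ?addr0// => w /andP[wt wv].
  by rewrite !ffunE !inE (negPf vtau) orbF eq_sym (negPf wv) mulr0.
have vt' : v \notin (tau :\ v)%SET by rewrite !inE eqxx.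
have tauE : tau = (v |: (tau :\ v))%SET by rewrite finset.setD1K.
rewrite [X in _ + _ * X](bigD1 v)//= -tauE mulrDr mulrA face_signM mul1r.
rewrite addrCA -[RHS]addr0; congr (_ + _).
rewrite mulr_sumr [X in _ + X](eq_bigl (fun w => w \notin tau)); last first.
  move=> w; rewrite !inE; have [->|] := eqVneq w v; last by rewrite andbT.
  by rewrite vtau.
rewrite -big_split/= big1// => w wt.
have wv : v != w by apply: contraNneq wt => <-.
have wt' : w \notin (tau :\ v)%SET by rewrite !inE negb_and wt orbT.
rewrite !ffunE !inE vtau orbT.
have -> : ((w |: tau) :\ v = w |: (tau :\ v))%SET.
  apply/setP => u; rewrite !inE.
  by have [->|//] := eqVneq u w; rewrite eq_sym wv.
rewrite !mulrA [X in X * _ + _](_ : _ = - (face_sign F (tau :\ v)%SET v *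
   face_sign F (tau :\ v)%SET w)); first by rewrite mulNr addNr.
have:= face_sign_anticomm vt' wt' wv; rewrite -tauE => h.
have s2 := face_signM (tau :\ v)%SET v.
rewrite -[face_sign F tau w]mulr1 -s2 (mulrA (face_sign F tau w)) h.
rewrite mulNr mulNr; congr (- _).
rewrite -!mulrA mulrCA; rewrite -[RHS]mul1r -(face_signM (w |: (tau :\ v))%SET v).
by ring.
Qed.

(* [K] is the union of a cone with apex [v] and isolated points. *)
Lemma cone_acyclic N K v : (0 < N)%N ->
  (forall sigma, sigma \in K -> (1 < #|sigma|)%N -> (v |: sigma)%SET \in K) ->
  (cycles F N K <= boundaries F N K)%VS.
Proof.
move=> N0 Kv; apply/subvP => c /cyclesP[/chainsP cK dc0]; apply/boundariesP.
exists (cone v c); last first.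
  rewrite -[LHS](boundary_cone v) dc0.
  suff -> : cone v 0 = 0 by rewrite addr0.
  by apply/ffunP => tau; rewrite !ffunE mulr0 if_same.
apply/chainsP => sigma; rewrite ffunE; case: ifPn; last by rewrite eqxx.
move=> vs; rewrite mulf_eq0 negb_or => /andP[_ /cK[sK sN]].
rewrite -(finset.setD1K vs) cardsU1 sN !inE eqxx; split => //.
(* Positive degree enters here: the simplices of the cycle have at least two vertices, so isolated
   points do not occur in it. *)
by apply: Kv => //; rewrite sN.
Qed.

(** This is the augmentation: in reduced homology a vertex is not a cycle, but a difference of two
    vertices is. *)
Lemma boundary_vertex v :
  boundary (elementary_chain F [set v]%SET) = elementary_chain F finset.set0.
Proof.
apply/ffunP => tau; rewrite !ffunE.
have [->|t0] := eqVneq tau finset.set0.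
  rewrite (bigD1 v)/= ?inE// big1.
    rewrite !ffunE finset.setU0 eqxx mulr1 addr0 /face_sign.
    rewrite (_ : [set w in _ | _]%SET = finset.set0) ?cards0//.
    by apply/setP => w; rewrite !inE.
  move=> w /andP[_ wv]; rewrite ffunE finset.setU0.
  case: eqP; last by rewrite mulr0.
  by move=> /set1_inj wv'; rewrite wv' eqxx in wv.
apply: big1 => w wt; rewrite ffunE; case: eqP; rewrite ?mulr0// => wtv.
case/set0Pn: t0 => u ut.
have : u \in [set v]%SET by rewrite -wtv !inE ut orbT.
have : w \in [set v]%SET by rewrite -wtv !inE eqxx.
by rewrite !inE => /eqP wv /eqP uv; move: wt; rewrite wv -uv ut.
Qed.

Lemma cone_elementary v tau : v \notin tau ->
  cone v (elementary_chain F tau) =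
  face_sign F tau v *: elementary_chain F (v |: tau)%SET.
Proof.
move=> vt; apply/ffunP => sigma; rewrite !ffunE /GRing.scale/=.
case: ifPn => vs.
  have [->|st] := eqVneq sigma (v |: tau)%SET; first by rewrite setU1K// eqxx.
  rewrite mulr0; case: eqP => [h|]; last by rewrite mulr0.
  by rewrite -h finset.setD1K// eqxx in st.
case: eqP => [h|]; last by rewrite mulr0.
by rewrite h !inE eqxx in vs.
Qed.

Lemma boundary_edge v w : v != w ->
  boundary (face_sign F [set w]%SET v *: elementary_chain F [set v; w]%SET) =
  elementary_chain F [set w]%SET - elementary_chain F [set v]%SET.
Proof.
move=> vw; rewrite -(@cone_elementary v [set w]%SET) ?inE//.
have := boundary_cone v (elementary_chain F [set w]%SET).
rewrite boundary_vertex (@cone_elementary v finset.set0) ?inE// finset.setU0.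
rewrite [face_sign F finset.set0 v]/face_sign (_ : [set w0 in _ | _]%SET = finset.set0); last first.
  by apply/setP => u; rewrite !inE.
by rewrite cards0 expr0 scale1r => /(canRL (addrK _)).
Qed.

(** Without edges [L] has no boundaries, so every 0-cycle of [K] survives in it. In [L'] the edge
    bounds the difference of its ends, a non-zero cycle of [K], so the rank drops by dim (Z :&: B) >
    0. *)
Lemma persistent_betti_edge K L L' v w : v != w ->
  [set v]%SET \in K -> [set w]%SET \in K -> [set v; w]%SET \in L' ->
  (forall sigma, sigma \in L -> (#|sigma| < 2)%N) ->
  (persistent_betti F 0 K L' < persistent_betti F 0 K L)%N.
Proof.
move=> vw vK wK vwL' L1.
have B0 : boundaries F 0 L = 0%VS.
  apply/eqP; rewrite -subv0; apply/subvP => c /boundariesP[b /chainsP bL ->].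
  suff -> : b = 0 by rewrite linear0 mem0v.
  apply/ffunP => sigma; rewrite ffunE; apply/eqP/negPn/negP => /bL[/L1].
  by move=> /[swap] ->.
rewrite /persistent_betti B0 addv0 dimv0 subn0.
set Z := cycles F 0 K; set B := boundaries F 0 L'.
pose f := elementary_chain F [set w]%SET - elementary_chain F [set v]%SET.
have fZB : f \in (Z :&: B)%VS.
  rewrite memv_cap; apply/andP; split.
    apply/cyclesP; split; last by rewrite linearB/= !boundary_vertex subrr.
    apply: rpredB; apply/chainsP => sigma; rewrite ffunE;
      by case: (sigma =P _) => [->|]; rewrite ?eqxx// cards1.
  apply/boundariesP; exists (face_sign F [set w]%SET v *:
    elementary_chain F [set v; w]%SET); last by rewrite boundary_edge.
  apply/rpredZ/chainsP => sigma; rewrite ffunE.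
  by case: (sigma =P _) => [->|]; rewrite ?eqxx// cards2 vw.
have f0 : f != 0.
  apply/eqP => /ffunP/(_ [set w]%SET); rewrite !ffunE eqxx.
  case: eqP => [/set1_inj wv|_]; first by rewrite wv eqxx in vw.
  by rewrite subr0; apply/eqP; exact: oner_neq0.
have : (0 < \dim (Z :&: B))%N.
  rewrite lt0n dimv_eq0; apply: contra f0 => /eqP ZB0.
  by rewrite -memv0 -ZB0.
have := dimv_sum_cap Z B.
have := dimv_leqif_sup (addvSr Z B) => -[leB _].
lia.
Qed.

End HomologyFacts.

(** * Rips diagrams *)

Section PersistenceFacts.
Variables (R : realType) (F : fieldType) (V : finType).
Variable K : R -> {set {set V}}.

Lemma multiplicity_gt0 N b d : (0 < multiplicity F K N (b, d))%N ->
  [/\ b < d, K b != before K b & K d != before K d].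
Proof.
rewrite /multiplicity; case: ifP => // bd mult_gt0.
split=> //; apply: contraTneq mult_gt0 => <-; first by rewrite subnn.
by rewrite subnn sub0n.
Qed.

(** The map from the homology of [K b] to that of [before K d] factors through [T], whose homology
    vanishes. *)
Lemma multiplicity_acyclic N b d (T : {set {set V}}) :
  {subset K b <= T} -> {subset T <= before K d} ->
  (cycles F N T <= boundaries F N T)%VS -> multiplicity F K N (b, d) = 0%N.
Proof.
move=> KT TK ac; rewrite /multiplicity; case: ifP => // _.
suff -> : persistent_betti F N (K b) (before K d) = 0%N by rewrite !sub0n.
apply/persistent_betti_eq0/(subv_trans _ (boundariesS F N TK))/subv_trans/ac.
by rewrite capvS// chainsS.
Qed.

End PersistenceFacts.

Section RipsFacts.
Variables (R : realType) (F : fieldType) (dim : nat).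
Implicit Types (X : {fset 'rV[R]_dim}) (u v : 'rV[R]_dim).

Definition dot u v : R := \sum_(k < dim) u 0 k * v 0 k.

Lemma enorm_ge0 u : 0 <= enorm u.
Proof. exact: sqrtr_ge0. Qed.

Lemma enorm0 : enorm (0 : 'rV[R]_dim) = 0.
Proof. by rewrite /enorm big1 ?sqrtr0// => k _; rewrite mxE expr0n. Qed.

Lemma sqr_enorm u : enorm u ^+ 2 = dot u u.
Proof.
rewrite sqr_sqrtr; last by apply: sumr_ge0 => k _; exact: sqr_ge0.
by apply: eq_bigr => k _; rewrite expr2.
Qed.

Lemma sqr_enormB u v : enorm (u - v) ^+ 2 = dot u u + dot v v - dot u v *+ 2.
Proof.
rewrite sqr_enorm /dot -big_split/= -sumrMnl -sumrB/=.
by apply: eq_bigr => k _; rewrite !mxE; ring.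
Qed.

Lemma enormBC u v : enorm (u - v) = enorm (v - u).
Proof.
by congr Num.sqrt; apply: eq_bigr => k _; rewrite !mxE -opprB sqrrN.
Qed.

Lemma enorm_gt0 u : u != 0 -> 0 < enorm u.
Proof.
move=> u0; rewrite sqrtr_gt0 lt_neqAle eq_sym sumr_ge0 ?andbT; last first.
  by move=> k _; exact: sqr_ge0.
apply: contra u0; rewrite psumr_eq0; last by move=> k _; exact: sqr_ge0.
move=> /allP u0; apply/eqP/rowP => k; rewrite mxE; apply/eqP.
by have := u0 k (mem_index_enum _); rewrite sqrf_eq0.
Qed.

Lemma rips_before X r sigma : (sigma \in before (rips X) r) =
  `[< exists2 q, q < r & sigma \in rips X q >].
Proof. by rewrite inE. Qed.

Lemma ripsP X r (sigma : {set X}) :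
  reflect {in sigma &, forall x y, enorm (val x - val y) <= 2 * r}
          (sigma \in rips X r).
Proof.
rewrite inE; apply: (iffP 'forall_in_'forall_in_idP) => h x y.
  by move=> *; exact: h.
by move=> *; exact: h.
Qed.

(** If no distance equals 2 r, the finitely many edges of a simplex present at r are all shorter, so
    it is present at half of their maximum, which is below r. *)
Lemma rips_critical X r : rips X r != before (rips X) r ->
  exists x y : X, 2 * r = enorm (val x - val y).
Proof.
apply: contra_neqP => /forallNP nr; apply/setP => sigma; rewrite rips_before.
apply/idP/asboolP => [/ripsP sr|[q qr /ripsP sq]]; last first.
  apply/ripsP => x y xs ys; apply: (le_trans (sq x y xs ys)).
  by rewrite ler_pM2l// ltW.
(* The default r - 1 serves the empty simplex; any value below r would do. *)
pose q := \big[Num.max/r - 1]_(p : X * X | (p.1 \in sigma) && (p.2 \in sigma))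
  (enorm (val p.1 - val p.2) / 2).
exists q.
  apply: bigmax_lt => [|[x y]/= /andP[xs ys]]; first by rewrite ltrBlDr ltrDl.
  rewrite ltr_pdivrMr// mulrC lt_neqAle sr// andbT; apply/eqP => h.
  by have /forallNP/(_ y) := nr x; rewrite h.
apply/ripsP => x y xs ys; rewrite mulrC -ler_pdivrMr//.
by apply: (le_bigmax_cond (r - 1) (fun p : X * X => enorm (val p.1 - val p.2) / 2)
   (j := (x, y))); rewrite xs.
Qed.

Lemma rips_diagram_gt0 N X p : (0 < rips_diagram F N X p)%N ->
  [/\ p.1 < p.2, exists x y : X, 2 * p.1 = enorm (val x - val y) &
      exists x y : X, 2 * p.2 = enorm (val x - val y)].
Proof.
case: p => b d /multiplicity_gt0[bd Kb Kd].
by split => //=; exact: rips_critical.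
Qed.

Lemma birth_ge0 N X p : (0 < rips_diagram F N X p)%N -> 0 <= p.1.
Proof.
move=> /rips_diagram_gt0[_ [x [y h]] _].
by have := enorm_ge0 (val x - val y); rewrite -h pmulr_rge0.
Qed.

Lemma death_le N X p M : (0 < rips_diagram F N X p)%N ->
  (forall x y, x \in X -> y \in X -> enorm (x - y) <= M) -> p.2 <= M / 2.
Proof.
move=> /rips_diagram_gt0[_ _ [x [y h]]] XM.
by rewrite ler_pdivlMr// mulrC h XM// fsvalP.
Qed.

(** A death exceeds a nonnegative birth, so the pair of points that realizes it is a pair of
    distinct points. *)
Lemma death_ge N X p m : (0 < rips_diagram F N X p)%N ->
  (forall x y, x \in X -> y \in X -> x != y -> m <= enorm (x - y)) ->
  m / 2 <= p.2.
Proof.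
move=> Np Xm; have := birth_ge0 Np; have [bd _ [x [y h]]] := rips_diagram_gt0 Np.
move=> b0; rewrite ler_pdivrMr// mulrC h Xm// ?fsvalP//.
apply: contraTneq (le_lt_trans b0 bd) => xy; rewrite -leNgt.
by rewrite -(@pmulr_rle0 _ 2)// h xy subrr enorm0.
Qed.

Lemma finite_rips_diagram N X : finite_set (support_set (rips_diagram F N X)).
Proof.
pose f (z : (X * X) * (X * X)) : R * R :=
  (enorm (val z.1.1 - val z.1.2) / 2, enorm (val z.2.1 - val z.2.2) / 2).
apply: (@sub_finite_set _ _ (f @` setT)); last first.
  exact/finite_image/finite_finset.
move=> [b d] /rips_diagram_gt0[_ [x [y /= h]] [x' [y' /= h']]].
exists ((x, y), (x', y')) => //; rewrite /f/= -h -h'.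
by congr pair; rewrite mulrC mulKf.
Qed.

(* If all cross products are small, the Rips complexes are close to the clique
   complexes of the threshold graphs [|x|^2 + |y|^2 <= t], in which the point of
   least norm is joined to every vertex that is not isolated. *)
Lemma rips_diagram_shrink N X delta p : (0 < N)%N ->
  (forall x y, x \in X -> y \in X -> x != y -> `|dot x y| <= delta) ->
  (0 < rips_diagram F N X p)%N -> p.2 ^+ 2 <= p.1 ^+ 2 + delta.
Proof.
case: p => b d N0 Xdelta Np /=; rewrite leNgt; apply/negP => bd.
have [_ [v _] _] := rips_diagram_gt0 Np.
have b0 : 0 <= b := birth_ge0 Np.
have [bd' _ _] := rips_diagram_gt0 Np; rewrite /= in bd'.
pose a (x : X) := dot (val x) (val x).
have [v0 _ v0min] := @arg_minP _ _ _ v xpredT a isT.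
(* Since |x - y|^2 = a x + a y - 2 [dot] x y, edges of length at most 2 b satisfy this bound, and
   the bound in turn gives |x - y|^2 <= 4 (b^2 + delta). So [T] lies between the Rips complexes at b
   and at sqrt (b^2 + delta). *)
pose T : {set {set X}} := [set sigma : {set X} | [forall x in sigma,
  forall y in sigma, (x != y) ==> (a x + a y <= (2 * b) ^+ 2 + delta *+ 2)]]%SET.
have TP (sigma : {set X}) : reflect {in sigma &, forall x y, x != y ->
    a x + a y <= (2 * b) ^+ 2 + delta *+ 2} (sigma \in T).
  rewrite inE; apply: (iffP 'forall_in_'forall_in_implyP) => h x y *;
    exact: h.
have vI (x y : X) : x != y -> val x != val y by apply: contra => /eqP/val_inj->.
suff : rips_diagram F N X (b, d) = 0%N by move: Np => /[swap] ->.
apply: (@multiplicity_acyclic _ _ _ _ _ _ _ T).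
- move=> sigma /ripsP sb; apply/TP => x y xs ys xy.
  have := sb x y xs ys; have := enorm_ge0 (val x - val y) => h0 h.
  have : enorm (val x - val y) ^+ 2 <= (2 * b) ^+ 2.
    by rewrite ler_sqr// nnegrE// (le_trans h0).
  rewrite sqr_enormB -/(a x) -/(a y).
  have := Xdelta _ _ (fsvalP x) (fsvalP y) (vI _ _ xy).
  by rewrite ler_norml => /andP[]; lra.
- move=> sigma /TP sT; rewrite rips_before; apply/asboolP.
  (* For a cloud with a single point the hypothesis on [delta] is vacuous and [delta] may be
     negative. *)
  have delta0 : 0 <= b ^+ 2 + Num.max 0 delta.
    by rewrite addr_ge0 ?sqr_ge0// le_max lexx.
  exists (Num.sqrt (b ^+ 2 + Num.max 0 delta)).
    rewrite -ltr_sqr ?nnegrE ?sqrtr_ge0 ?(le_trans b0 (ltW _))// sqr_sqrtr//.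
    case: (leP 0 delta) => // _; rewrite addr0 ltr_sqr// nnegrE.
    exact: le_trans (ltW bd').
  apply/ripsP => x y xs ys.
  rewrite -ler_sqr ?nnegrE ?enorm_ge0 ?mulr_ge0 ?sqrtr_ge0//.
  rewrite exprMn (sqr_sqrtr delta0); have [->|xy] := eqVneq x y.
    by rewrite subrr enorm0 expr0n mulr_ge0// sqr_ge0.
  have := sT _ _ xs ys xy; rewrite sqr_enormB -/(a x) -/(a y).
  have := Xdelta _ _ (fsvalP x) (fsvalP y) (vI _ _ xy).
  have : delta <= Num.max 0 delta by rewrite le_max lexx orbT.
  rewrite ler_norml => ? /andP[]; rewrite exprMn; lra.
- apply: (@cone_acyclic _ _ _ _ v0) => // sigma /TP sT /card_gt1P[z [z' [zs zs' zz']]].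
  (* A vertex of [sigma] has a neighbour in [sigma]; replacing that neighbour by the minimizer [v0]
     of [a] can only lower the sum. *)
  have v0x x : x \in sigma -> a v0 + a x <= (2 * b) ^+ 2 + delta *+ 2.
    move=> xs; have [y ys xy] : exists2 y, y \in sigma & x != y.
      by have [xz|] := eqVneq x z; [exists z' => //; rewrite xz|exists z].
    by apply: le_trans (sT x y xs ys xy); rewrite addrC lerD2l v0min.
  apply/TP => x y; rewrite !inE => /orP[/eqP->|xs] /orP[/eqP->|ys].
  - by rewrite eqxx.
  - by move=> _; exact: v0x.
  - by move=> _; rewrite addrC; exact: v0x.
  - exact: sT.
Qed.

(** A closest pair provides the point: before half its distance the complex has no edge, and at that
    parameter an edge merges two components born at 0. *)
Lemma rips_diagram0_nonempty X u v : u \in X -> v \in X -> u != v ->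
  exists d, (0 < rips_diagram F 0 X (0, d)%R)%N.
Proof.
move=> uX vX uv.
pose P (p : X * X) := p.1 != p.2.
have P0 : P ([` uX]%fset, [` vX]%fset).
  by apply: contra uv => /eqP/(congr1 val)/= ->.
have [[x y] Pxy xymin] :=
  arg_minP (fun p : X * X => enorm (val p.1 - val p.2)) P0.
rewrite /P/= in Pxy xymin.
exists (enorm (val x - val y) / 2).
have xy0 : 0 < enorm (val x - val y).
  by apply: enorm_gt0; rewrite subr_eq0; apply: contra Pxy => /eqP/val_inj->.
rewrite /rips_diagram /multiplicity divr_gt0//.
(* At negative parameters even single vertices are excluded, as the zero distance of a point to
   itself is too large. *)
have K0 L : persistent_betti F 0 (before (rips X) 0) L = 0%N.
  apply: persistent_betti_eq0; apply/subvP => c /cyclesP[/chainsP cK _].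
  suff -> : c = 0 by rewrite mem0v.
  apply/ffunP => sigma; rewrite [RHS]ffunE; apply/eqP/negPn/negP.
  move=> /cK[]; rewrite rips_before => /asboolP[q q0 /ripsP sq] /eqP.
  case/cards1P => z sz; have := sq z z; rewrite sz !inE eqxx => /(_ isT isT).
  apply/negP; rewrite -ltNge (lt_le_trans _ (enorm_ge0 _))//.
  by rewrite pmulr_rlt0.
have v1 z : [set z]%SET \in rips X 0.
  apply/ripsP => a b; rewrite !inE => /eqP-> /eqP->.
  by rewrite subrr mulr0 enorm0.
rewrite !K0 subnn subn0 subn_gt0; apply: (@persistent_betti_edge F X _ _ _ x y) => //.
  apply/ripsP => a b; rewrite [2 * _]mulrC divfK//.
  rewrite !inE => /orP[] /eqP-> /orP[] /eqP->; rewrite ?subrr ?enorm0 ?enorm_ge0//.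
  by rewrite enormBC.
move=> sigma; rewrite rips_before => /asboolP[q qd /ripsP sq].
rewrite ltnNge; apply/negP => /card_gt1P[z [z' [zs zs' zz']]].
have := xymin (z, z') zz'; rewrite /= leNgt => /negP; apply.
by rewrite (le_lt_trans (sq _ _ zs zs'))// mulrC -ltr_pdivlMr.
Qed.

End RipsFacts.

(** * Bottleneck and Hausdorff distances *)

Section DistanceFacts.
Local Open Scope card_scope.
Variable R : realType.
Implicit Types (D : R * R -> nat) (p q : R * R).

Lemma ler_normB p q (c : R) : (`|p - q| <= c) =
  (`|p.1 - q.1| <= c) && (`|p.2 - q.2| <= c).
Proof. by rewrite prod_normE ge_max. Qed.

Lemma normB_diagonal p t : (p.2 - p.1) / 2 <= `|p - (t, t)|.
Proof.
rewrite prod_normE le_max/=.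
have [h|h] := leP (p.1 + p.2) (t *+ 2); apply/orP; [left|right].
  by rewrite distrC; apply: le_trans (ler_norm _); lra.
by apply: le_trans (ler_norm _); lra.
Qed.

(** The points whose nearest diagonal point in the maximum norm is (t, t). *)
Definition midpoint_fiber D (t : R) : set ((R * R) * nat) :=
  [set a | Defs.extended D a /\ (a.1.1 + a.1.2) / 2 = t].

(** Countable because the support is finite, infinite because of the copies of (t, t). *)
Lemma midpoint_fiber_card D t : 0 <= t -> finite_set (support_set D) ->
  midpoint_fiber D t #= [set: nat].
Proof.
move=> t0 fD; apply: eq_card_nat.
  apply: (@sub_countable _ _ _ ((support_set D `|` [set (t, t)]) `*` setT)).
    apply: subset_card_le => -[[b d] k] [[/= Dp|/= [b0 ->]] mid]; split => //=.
      by left; exact: leq_ltn_trans Dp.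
    by right; congr pair; rewrite -mid; field.
  apply: countableX => //; apply: finite_set_countable.
  by rewrite finite_setU; split => //; exact: finite_set1.
move=> fin; have : finite_set ((fun k : nat => ((t, t), k)) @^-1` midpoint_fiber D t).
  by apply: finite_preimage fin => k l _ _ [].
rewrite (_ : _ @^-1` _ = setT); first exact: infinite_nat.
by apply/seteqP; split => // k _; split; [right|rewrite /=; field].
Qed.

(* The diagonal absorbs countably many points over each of its points, so the
   extended diagrams are matched fibrewise along the midpoint projection. *)
Lemma bottleneck_le D D' (c : R) :
  finite_set (support_set D) -> finite_set (support_set D') -> 0 <= c ->
  (forall p, (0 < D p)%N -> 0 <= p.1 < p.2 /\ p.2 - p.1 <= c *+ 2) ->
  (forall p, (0 < D' p)%N -> 0 <= p.1 < p.2 /\ p.2 - p.1 <= c *+ 2) ->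
  (bottleneck D D' <= c%:E)%E.
Proof.
move=> fD fD' c0 Dc D'c.
have ext E a : (forall p, (0 < E p)%N -> 0 <= p.1 < p.2 /\ p.2 - p.1 <= c *+ 2) ->
    Defs.extended E a -> [/\ 0 <= a.1.1, a.1.1 <= a.1.2 & a.1.2 - a.1.1 <= c *+ 2].
  move=> Ec [Ea|[a0 <-]]; last by rewrite subrr mulrn_wge0.
  by have [/andP[? /ltW]] := Ec a.1 (leq_ltn_trans (leq0n _) Ea).
have ge0 E a : (forall p, (0 < E p)%N -> 0 <= p.1 < p.2 /\ p.2 - p.1 <= c *+ 2) ->
    Defs.extended E a -> 0 <= (a.1.1 + a.1.2) / 2.
  by move=> Ec /(ext _ _ Ec)[? ? ?]; lra.
(* Midpoints are nonnegative; for t < 0 the identity is a mere default. *)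
have /choice[f fbij] : forall t, exists f, 0 <= t ->
    set_bij (midpoint_fiber D t) (midpoint_fiber D' t) f.
  move=> t; have [t0|t0] := leP 0 t; last by exists id.
  suff /card_set_bijP[f] : midpoint_fiber D t #= midpoint_fiber D' t by exists f.
  apply: card_eq_trans (midpoint_fiber_card t0 fD) _.
  by rewrite card_eq_sym; exact: midpoint_fiber_card.
pose eta (a : R * R * nat) := f ((a.1.1 + a.1.2) / 2) a.
have etaP a : Defs.extended D a -> midpoint_fiber D' ((a.1.1 + a.1.2) / 2) (eta a).
  move=> Da; have [fun_f _ _] := fbij _ (ge0 _ _ Dc Da).
  exact: fun_f.
apply: (@le_trans _ _ (ereal_sup [set `|a.1 - (eta a).1|%:E | a in Defs.extended D])).
  apply: ereal_inf_lbound; exists eta => //; split.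
  - by move=> a /etaP[].
  - move=> a b /[!inE] Da Db eab.
    have [_ ma] := etaP _ Da; have [_ mb] := etaP _ Db.
    have mab : (a.1.1 + a.1.2) / 2 = (b.1.1 + b.1.2) / 2 by rewrite -ma -mb eab.
    have [_ inj_f _] := fbij _ (ge0 _ _ Dc Da).
    by apply: inj_f; rewrite ?inE//; move: eab; rewrite /eta -mab.
  - move=> b Db; have [_ _ surj_f] := fbij _ (ge0 _ _ D'c Db).
    have [a [Da ma] fab] := surj_f b (conj Db erefl).
    by exists a => //; rewrite /eta ma.
(* With the common midpoint t, both births lie in [t - c, t] and both deaths in [t, t + c]; hence
   the cost is c and not 2 c. *)
apply: ge_ereal_sup => _ [a Da <-]; rewrite lee_fin ler_normB.
have [D'b mid] := etaP a Da.
have [? ? ?] := ext _ _ Dc Da; have [? ? ?] := ext _ _ D'c D'b.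
by rewrite !ler_norml; apply/andP; split; apply/andP; split; lra.
Qed.

Lemma bottleneck_ge0 D D' : (0 <= bottleneck D D')%E.
Proof.
apply: le_ereal_inf_tmp => _ [eta _ <-].
(* The origin belongs to the diagonal, so the supremum is over a non-empty set. *)
apply: (@le_trans _ _ (`|0 - (eta (0, 0%N)).1|%:E)); first by rewrite lee_fin.
by apply: ereal_sup_ubound; exists (0, 0%N) => //; right.
Qed.

Lemma normB_snd p q : p.2 - q.2 <= `|p - q|.
Proof. by rewrite prod_normE le_max (ler_norm (p.2 - q.2)) orbT. Qed.

(** A bijection sends [p] either to a point of [D'] or to the diagonal, and the latter costs at
    least half the persistence of [p]. *)
Lemma bottleneck_ge_left D D' p (c : R) : (0 < D p)%N ->
  (forall q, (0 < D' q)%N -> c <= `|p - q|) -> c *+ 2 <= p.2 - p.1 ->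
  (c%:E <= bottleneck D D')%E.
Proof.
move=> Dp cD' cp; apply: le_ereal_inf_tmp => _ [eta [eta_fun _ _] <-].
apply: (@le_trans _ _ (`|p - (eta (p, 0%N)).1|%:E)); last first.
  by apply: ereal_sup_ubound; exists (p, 0%N) => //; left.
have [] := eta_fun (p, 0%N) (or_introl Dp).
  by move=> Dq; rewrite lee_fin cD'//; exact: leq_ltn_trans Dq.
case: (eta _) => -[t _] _/= [_ <-]; rewrite lee_fin.
by apply: le_trans (normB_diagonal _ _); lra.
Qed.

Lemma bottleneck_ge_right D D' p (c : R) : (0 < D' p)%N ->
  (forall q, (0 < D q)%N -> c <= `|p - q|) -> c *+ 2 <= p.2 - p.1 ->
  (c%:E <= bottleneck D D')%E.
Proof.
move=> D'p cD cp; apply: le_ereal_inf_tmp => _ [eta [_ _ eta_surj] <-].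
have [a Da ea] := eta_surj (p, 0%N) (or_introl D'p).
apply: (@le_trans _ _ (`|a.1 - (eta a).1|%:E)); last first.
  by apply: ereal_sup_ubound; exists a.
rewrite ea distrC; case: Da => [Dq|].
  by rewrite lee_fin cD//; exact: leq_ltn_trans Dq.
case: a {ea} => -[t _] _/= [_ <-]; rewrite lee_fin.
by apply: le_trans (normB_diagonal _ _); lra.
Qed.

(** An empty [B] is covered as well: the infimum is then +oo. *)
Lemma hausdorff_ge (A B : set (R * R)) p (c : R) : A p ->
  (forall q, B q -> c <= `|p - q|) -> (c%:E <= hausdorff A B)%E.
Proof.
move=> Ap cB; rewrite /hausdorff !le_max; apply/orP; right; apply/orP; left.
apply: (@le_trans _ _ (ereal_inf [set `|p - b|%:E | b in B])).
  by apply: le_ereal_inf_tmp => _ [b Bb <-]; rewrite lee_fin cB.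
by apply: ereal_sup_ubound; exists p.
Qed.

End DistanceFacts.

(** * Second moments and independence *)

Section SecondMoments.
Context {R : realType} {dT : measure_display} {T : measurableType dT}.
Variable P : probability T R.
Implicit Types (X Y Z W : T -> R).
Local Open Scope ereal_scope.

Lemma chebyshev_outer Z (c a : R) : measurable_fun setT Z ->
  (0 < a)%R -> \int[P]_w (Z w ^+ 2)%:E <= c%:E ->
  outer_prob P [set w | (a < `|Z w|)%R] <= (c / a ^+ 2)%:E.
Proof.
move=> mZ a0 Zc.
have mZ2 : measurable_fun setT (fun w => (Z w ^+ 2)%:E).
  by apply/measurable_EFinP/measurable_funX.
rewrite outer_probE; last first.
  rewrite -[X in measurable X]setTI; apply: measurable_fun_ltr => //.
  exact: measurableT_comp.
rewrite EFinM lee_pdivlMr ?exprn_gt0// muleC.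
apply: le_trans (le_trans (le_integral_abse P measurableT mZ2 (exprn_gt0 2 a0)) _).
  apply: lee_wpmul2l; first by rewrite lee_fin exprn_ge0// ltW.
  apply: le_measure; rewrite ?inE.
  - rewrite -[X in measurable X]setTI; apply: measurable_fun_ltr => //.
    exact: measurableT_comp.
  - by apply: emeasurable_fun_c_infty => //; exact: measurableT_comp.
  - move=> w /= aZ; split => //; rewrite lee_fin normrX ler_sqr ?nnegrE ?(ltW aZ)//.
    exact: ltW.
apply: le_trans Zc; apply: ge0_le_integral => //.
- exact: measurableT_comp.
- by move=> w _; rewrite gee0_abs// lee_fin sqr_ge0.
Qed.

Lemma integrableM_L2 Z W : measurable_fun setT Z -> measurable_fun setT W ->
  \int[P]_w (Z w ^+ 2)%:E < +oo -> \int[P]_w (W w ^+ 2)%:E < +oo ->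
  P.-integrable setT (fun w => (Z w * W w)%:E).
Proof.
have sq_int Y : measurable_fun setT Y -> \int[P]_w (Y w ^+ 2)%:E < +oo ->
    P.-integrable setT (fun w => (Y w ^+ 2)%:E).
  move=> mY Yoo; apply/integrableP; split.
    exact/measurable_EFinP/measurable_funX.
  apply: le_lt_trans Yoo; apply: ge0_le_integral => //.
  - exact/measurableT_comp/measurable_EFinP/measurable_funX.
  - exact/measurable_EFinP/measurable_funX.
  - by move=> w _; rewrite gee0_abs// lee_fin sqr_ge0.
move=> mZ mW /(sq_int _ mZ) iZ /(sq_int _ mW) iW.
apply: le_integrable (integrableD measurableT iZ iW) => //.
  by apply/measurable_EFinP/measurable_funM.
move=> w _ /=; rewrite lee_fin normrM [leRHS]ger0_norm; last first.
  by rewrite addr_ge0 ?sqr_ge0.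
rewrite -(real_normK (num_real (Z w))) -(real_normK (num_real (W w))).
have := normr_ge0 (Z w); have := normr_ge0 (W w).
by move: `|Z w|%R `|W w|%R => a b; nra.
Qed.

Lemma integral_orthogonal_sum (I : finType) (Z : I -> T -> R) (a : I -> R) (v : R) :
  (forall i, measurable_fun setT (Z i)) ->
  (forall i j, \int[P]_w (Z i w * Z j w)%:E = (if i == j then v else 0)%:E) ->
  \int[P]_w ((\sum_i a i * Z i w) ^+ 2)%:E = (v * \sum_i a i ^+ 2)%:E.
Proof.
move=> mZ orth.
have iZ i j : P.-integrable setT (fun w => (Z i w * Z j w)%:E).
  by apply: integrableM_L2 => //; under eq_integral do rewrite expr2;
    rewrite orth eqxx ltry.
transitivity (\int[P]_w \sum_i \sum_j (a i * a j)%:E * (Z i w * Z j w)%:E).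
  apply: eq_integral => w _; rewrite expr2 mulr_suml -sumEFin; apply: eq_bigr => i _.
  by rewrite mulr_sumr -sumEFin; apply: eq_bigr => j _; rewrite -EFinM; congr EFin; ring.
rewrite integral_sum//; last first.
  by move=> i; apply: integrable_sum => // j _; apply: integrableZl.
rewrite mulr_sumr -sumEFin; apply: eq_bigr => i _.
rewrite integral_sum//; last by move=> j; apply: integrableZl.
rewrite (bigD1 i)//= integralZl// orth eqxx -EFinM big1 ?adde0.
  by congr EFin; rewrite -expr2 mulrC.
by move=> j ji; rewrite integralZl// orth eq_sym (negPf ji) mule0.
Qed.

End SecondMoments.

Section Independence.
Context {R : realType} {dT dU dV : measure_display} {T : measurableType dT}.
Context {U : measurableType dU} {V : measurableType dV}.
Variables (P : probability T R) (X : {RV P >-> U}) (Y : {RV P >-> V}).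
Local Open Scope ereal_scope.

Hypothesis indep : forall A B, measurable A -> measurable B ->
  P (X @^-1` A `&` Y @^-1` B) = P (X @^-1` A) * P (Y @^-1` B).

Let XY w := (X w, Y w).

Let mXY : measurable_fun setT XY.
Proof. exact: measurable_fun_pair. Qed.

HB.instance Definition _ := isMeasurableFun.Build _ _ _ _ XY mXY.

(** Independence is the equality on rectangles, which determine the product measure. *)
Let joint_law A : measurable A ->
  distribution P XY A = (distribution P X \x distribution P Y) A.
Proof.
by move=> mA; rewrite (product_measure_unique (m' := distribution P XY)).
Qed.

Lemma indep_tonelli (f : U * V -> \bar R) : measurable_fun setT f ->
  (forall z, 0 <= f z) ->
  \int[P]_w f (X w, Y w) = \int[P]_w \int[P]_w' f (X w, Y w').
Proof.
move=> mf f0.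
transitivity (\int[distribution P XY]_z f z).
  by rewrite ge0_integral_distribution.
rewrite (eq_measure_integral (distribution P X \x distribution P Y)); last first.
  by move=> A mA _; exact: joint_law.
rewrite fubini_tonelli1// ge0_integral_distribution//; last first.
- by move=> x; apply: integral_ge0.
- exact: measurable_fun_fubini_tonelli_F.
apply: eq_integral => w _ /=; rewrite /fubini_F ge0_integral_distribution//.
exact: measurable_fun_pair2.
Qed.

Lemma indep_fubini (f : U * V -> \bar R) : measurable_fun setT f ->
  P.-integrable setT (fun w => f (X w, Y w)) ->
  (forall x, P.-integrable setT (fun w => f (x, Y w))) ->
  (forall x, \int[P]_w f (x, Y w) = 0) ->
  \int[P]_w f (X w, Y w) = 0.
Proof.
move=> mf intf int2 f0.
transitivity (\int[distribution P XY]_z f z).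
  by rewrite integral_distribution.
rewrite (eq_measure_integral (distribution P X \x distribution P Y)); last first.
  by move=> A mA _; exact: joint_law.
rewrite -integral12_prod_meas1.
  rewrite -[RHS](integral0 (distribution P X) setT); apply: eq_integral => x _.
  rewrite /fubini_F integral_distribution//; first exact: f0.
    exact: measurable_fun_pair2.
  exact: int2.
have : (distribution P XY).-integrable setT f by exact: integrable_pushforward.
move=> /integrableP[_ foo]; apply/integrableP; split => //.
rewrite (eq_measure_integral (distribution P XY))// => A mA _.
exact/esym/joint_law.
Qed.

End Independence.

(** * Moments of the noise *)

Lemma independent_family_pair {R : realType} {dT dU : measure_display}
    {T : measurableType dT} {U : measurableType dU} (P : probability T R)
    (J : finType) (X : J -> T -> U) (i j : J) (A B : set U) :
  independent_family P X -> i != j -> measurable A -> measurable B ->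
  (P (X i @^-1` A `&` X j @^-1` B) = P (X i @^-1` A) * P (X j @^-1` B))%E.
Proof.
move=> indX ij mA mB; have ji : j != i by rewrite eq_sym.
pose C l := if l == i then A else if l == j then B else setT.
have := indX C; rewrite (bigD1 i)//= (bigD1 j)//= big1 => [|l /andP[li lj]].
  rewrite mule1 /C eqxx (negPf ji) eqxx => <-; last first.
    by move=> l; case: ifP => // _; case: ifP.
  congr (P _); apply/seteqP; split=> w /=.
    by move=> [Aw Bw] l _ /=; case: eqP => [->//|_]; case: eqP => [->//|].
  move=> CX; have := CX i I; have := CX j I.
  by rewrite /= eqxx (negPf ji) eqxx.
by rewrite /C (negPf li) (negPf lj) preimage_setT probability_setT.
Qed.

Section NoiseMoments.
Context {R : realType} {n d : nat} {dT : measure_display}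
  {T : measurableType dT} {P : probability T R}.
Variables (mu : probability (measurableTypeR R) R) (nu : R).
Variable e : 'I_n -> {RV P >-> d.-tuple (measurableTypeR R)}.
Hypothesis noise : noise_cloud mu nu e.
Local Open Scope ereal_scope.

Definition noise_coord i k w : measurableTypeR R := tnth (e i w) k.

Lemma measurable_noise_coord i k : measurable_fun setT (noise_coord i k).
Proof. exact: measurableT_comp (measurable_tnth k) _. Qed.

HB.instance Definition _ i k :=
  isMeasurableFun.Build _ _ _ _ _ (measurable_noise_coord i k).

Lemma measurable_noise_coordR i k :
  measurable_fun [set: T] (fun w => noise_coord i k w : R).
Proof. exact: measurable_noise_coord. Qed.

Lemma noise_integral_ge0 i k (f : measurableTypeR R -> \bar R) :
  measurable_fun setT f -> (forall y, 0 <= f y) ->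
  \int[P]_w f (noise_coord i k w) = \int[mu]_y f y.
Proof.
move=> mf f0; rewrite -(ge0_integral_distribution (noise_coord i k) mf f0).
by apply: eq_measure_integral => A mA _; exact: noise_coord_law noise i k A mA.
Qed.

Lemma noise_integral i k (f : measurableTypeR R -> \bar R) :
  measurable_fun setT f -> P.-integrable setT (f \o noise_coord i k) ->
  \int[P]_w f (noise_coord i k w) = \int[mu]_y f y.
Proof.
move=> mf intf; rewrite -(integral_distribution (X := noise_coord i k) mf intf).
by apply: eq_measure_integral => A mA _; exact: noise_coord_law noise i k A mA.
Qed.

Lemma noise_covariance i k l :
  \int[P]_w ((noise_coord i k w : R) * noise_coord i l w)%:E =
  (if k == l then nu else 0%R)%:E.
Proof.
have := noise_cov noise i k l; rewrite unlock unlock.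
have Em m : 'E_P[fun w => tnth (e i w) m : R] = 0 by exact: noise_mean noise i m.
rewrite unlock in Em; rewrite !Em.
rewrite (_ : (if k == l then nu else 0%R)%:E = if k == l then nu%:E else 0); last first.
  by case: ifP.
move=> <-; apply: eq_integral => w _; congr EFin.
by rewrite /noise_coord; cbn; rewrite !subr0.
Qed.

Lemma noise_linear_moment i (a : 'I_d -> R) :
  \int[P]_w ((\sum_k a k * noise_coord i k w) ^+ 2)%:E =
  (nu * \sum_k a k ^+ 2)%:E.
Proof.
apply: integral_orthogonal_sum => k; first exact: measurable_noise_coordR.
by move=> l; exact: noise_covariance.
Qed.

(** With e_i frozen, the sum is a linear form in e_j with second moment nu |e_i|^2; averaging over
    e_i gives nu (nu d). *)
Lemma noise_bilinear_moment i j : (0 <= nu)%R -> i != j ->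
  \int[P]_w ((\sum_k (noise_coord i k w : R) * noise_coord j k w) ^+ 2)%:E =
  (nu ^+ 2 * d%:R)%:E.
Proof.
move=> nu0 ij.
pose f (z : d.-tuple (measurableTypeR R) * d.-tuple (measurableTypeR R)) :=
  ((\sum_k (tnth z.1 k : R) * tnth z.2 k) ^+ 2)%:E.
rewrite (@indep_tonelli _ _ _ _ _ _ _ P (e i) (e j) _ f); first last.
- by move=> z; rewrite lee_fin sqr_ge0.
- apply/measurable_EFinP/measurable_funX/measurable_sum => k.
  apply: measurable_funM.
    exact: (measurableT_comp (measurable_tnth k) measurable_fst).
  exact: (measurableT_comp (measurable_tnth k) measurable_snd).
- move=> A B mA mB; exact: (independent_family_pair (noise_indep noise)).
under eq_integral => w _ do rewrite /f/= noise_linear_moment.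
have mk k : measurable_fun setT (fun w => ((noise_coord i k w : R) ^+ 2)%:E).
  by apply/measurable_EFinP; apply: measurable_funX; exact: measurable_noise_coordR.
have k2 k : \int[P]_w ((noise_coord i k w : R) ^+ 2)%:E = nu%:E.
  by under eq_integral => w _ do rewrite expr2; rewrite noise_covariance eqxx.
under eq_integral => w _ do rewrite EFinM -sumEFin.
rewrite ge0_integralZl_EFin//; last 2 first.
- by move=> w _; apply: sume_ge0 => k _; rewrite lee_fin sqr_ge0.
- exact: emeasurable_sum.
rewrite ge0_integral_sum//; last by move=> k w _; rewrite lee_fin sqr_ge0.
rewrite (eq_bigr (fun=> nu%:E)) => [|k _]; last exact: k2.
rewrite sumEFin big_const_ord iter_addr_0 -EFinM; congr EFin.
by rewrite -[(nu *+ d)%R]mulr_natr expr2 mulrA.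
Qed.

(** Independent centred variables are orthogonal, so the d variances add up. The cases of interest
    are a centred indicator and y^2 - nu. *)
Lemma noise_empirical_moment i (g : R -> R) (v : R) :
  measurable_fun setT g -> \int[mu]_y (g y)%:E = 0 ->
  \int[mu]_y (g y ^+ 2)%:E = v%:E ->
  \int[P]_w ((\sum_k g (noise_coord i k w)) ^+ 2)%:E = (v * d%:R)%:E.
Proof.
move=> mg g0 g2.
have mgk k : measurable_fun [set: T] (fun w => g (noise_coord i k w)).
  exact: measurableT_comp mg (measurable_noise_coordR i k).
have gk2 k : \int[P]_w (g (noise_coord i k w) ^+ 2)%:E = v%:E.
  rewrite -g2 (noise_integral_ge0 i k (f := fun y => (g y ^+ 2)%:E))//.
    exact/measurable_EFinP/measurable_funX.
  by move=> y; rewrite lee_fin sqr_ge0.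
have int1 k : P.-integrable setT (fun w => (g (noise_coord i k w))%:E).
  (* On a probability space square integrability implies integrability, by multiplication with the
     constant 1. *)
  have := @integrableM_L2 _ _ _ P _ (cst 1%R) (mgk k) (measurable_cst _).
  rewrite gk2 ltry (_ : \int[P]_w (cst 1%R w ^+ 2)%:E = 1) ?ltry => [|]; last first.
    by under eq_integral do rewrite expr1n; have := expectation_cst P 1%R; rewrite unlock.
  move=> /(_ isT isT); apply: eq_integrable => // w _.
  by rewrite /= mulr1.
have gk1 k : \int[P]_w (g (noise_coord i k w))%:E = 0.
  rewrite -g0 (@noise_integral i k (fun y => (g y)%:E))//.
    exact/measurable_EFinP.
  exact: int1.
have orth k l : \int[P]_w (g (noise_coord i k w) * g (noise_coord i l w))%:E =
    (if k == l then v else 0%R)%:E.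
  have [<-|kl] := eqVneq k l.
    by under eq_integral do rewrite -expr2; exact: gk2.
  apply: (@indep_fubini _ _ _ _ _ _ _ P (noise_coord i k) (noise_coord i l) _
    (fun z => (g z.1 * g z.2)%:E)).
  - move=> A B mA mB.
    exact: (independent_family_pair (noise_coord_indep noise i)).
  - apply/measurable_EFinP/measurable_funM; exact: measurableT_comp.
  - by have := @integrableM_L2 _ _ _ P _ _ (mgk k) (mgk l); rewrite !gk2 !ltry; exact.
  - by move=> x; under eq_fun do rewrite EFinM; exact: (integrableZl measurableT (g x) (int1 l)).
  - move=> x; rewrite -[RHS](mule0 (g x)%:E) -(gk1 l) -integralZl//.
have := integral_orthogonal_sum (fun=> 1%R) mgk orth.
under eq_integral do under eq_bigr do rewrite mul1r.
move=> ->; rewrite (eq_bigr (fun=> 1%R)) => [|k _]; last by rewrite expr1n.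
by rewrite big_const_ord iter_addr_0.
Qed.

End NoiseMoments.

(** * Asymptotics in probability *)

Section LikelyEvents.
Variables (R : realType) (disp : nat -> measure_display).
Variables (T : forall d, measurableType (disp d)).
Variables (P : forall d, probability (T d) R).
Implicit Types (Q : R -> forall d, T d -> Prop) (X : forall d, T d -> \bar R).
Local Open Scope ereal_scope.

(* [likely (fun C d w => `|X d w| <= C)] expresses that [X] is [O_P(1)]. *)
Definition likely Q := forall eps : R, (0 < eps)%R -> exists (C : R) (M : nat),
  forall d, (M < d)%N -> outer_prob (P d) [set w | ~ Q C d w] <= eps%:E.

(** Allows finitely many likely events to share the largest of their constants. *)
Definition monotone_in_bound Q :=
  forall (C C' : R) d w, (C <= C')%R -> Q C d w -> Q C' d w.

Lemma outer_probS d (A B : set (T d)) : A `<=` B ->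
  outer_prob (P d) A <= outer_prob (P d) B.
Proof. exact: le_outer_measure. Qed.

Lemma outer_probU d (A B : set (T d)) :
  outer_prob (P d) (A `|` B) <= outer_prob (P d) A + outer_prob (P d) B.
Proof. exact: outer_measureU2. Qed.

(** Serves both refutations, of boundedness and of convergence: two improbable sets cannot cover the
    space. *)
Lemma outer_prob_cover d (A B : set (T d)) (a b : R) : A `|` B = setT ->
  outer_prob (P d) A <= a%:E -> outer_prob (P d) B <= b%:E -> (1 <= a + b)%R.
Proof.
move=> AB Aa Bb; rewrite -lee_fin EFinD -(probability_setT (P d)).
by rewrite -outer_probE// -AB (le_trans (outer_probU A B))// leeD.
Qed.

Lemma likely_always Q : (forall C d w, Q C d w) -> likely Q.
Proof.
move=> QT eps eps0; exists 0%R, 0%N => d _; rewrite (_ : [set _ | _] = set0).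
  by rewrite /outer_prob outer_measure0 lee_fin ltW.
by apply/seteqP; split => // w /=; apply.
Qed.

(** The passage from probability to deterministic geometry: the new constant and the threshold for d
    depend on [C] only, not on the outcome. *)
Lemma likely_sub Q Q' :
  (forall C, exists C' M, forall d w, (M < d)%N -> Q C d w -> Q' C' d w) ->
  likely Q -> likely Q'.
Proof.
move=> QQ' likelyQ eps /likelyQ[C [M CM]]; have [C' [M' QC]] := QQ' C.
exists C', (maxn M M') => d; rewrite gtn_max => /andP[Md M'd].
apply: le_trans (CM d Md); apply: outer_probS => w /= nQ'.
by move=> /(QC _ _ M'd).
Qed.

Lemma likely_and Q Q' : monotone_in_bound Q -> monotone_in_bound Q' ->
  likely Q -> likely Q' -> likely (fun C d w => Q C d w /\ Q' C d w).
Proof.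
move=> mQ mQ' lQ lQ' eps eps0; have eps2 : (0 < eps / 2)%R by rewrite divr_gt0.
have [C [M CM]] := lQ _ eps2; have [C' [M' CM']] := lQ' _ eps2.
exists (Num.max C C'), (maxn M M') => d; rewrite gtn_max => /andP[Md M'd].
rewrite [eps]splitr EFinD; apply: le_trans (leeD (CM d Md) (CM' d M'd)).
apply: le_trans (outer_probU _ _); apply: outer_probS => w /= /not_andP[nQ|nQ'].
  by left; apply: contra_not nQ; apply: mQ; rewrite le_max lexx.
by right; apply: contra_not nQ'; apply: mQ'; rewrite le_max lexx orbT.
Qed.

Lemma likely_forall (I : finType) (Q : I -> R -> forall d, T d -> Prop) :
  (forall i, monotone_in_bound (Q i)) -> (forall i, likely (Q i)) ->
  likely (fun C d w => forall i, Q i C d w).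
Proof.
move=> mQ lQ.
suff : likely (fun C d w => forall i, i \in enum I -> Q i C d w).
  by apply: likely_sub => C; exists C, 0%N => d w _ QC i; apply: QC; rewrite mem_enum.
elim: (enum I) => [|i s IHs].
  exact: likely_always.
have ms : monotone_in_bound (fun C d w => forall j, j \in s -> Q j C d w).
  by move=> C C' d w CC' QC j js; apply: mQ CC' (QC j js).
apply: likely_sub (likely_and (mQ i) ms (lQ i) IHs) => C.
exists C, 0%N => d w _ [Qi Qs] j.
by rewrite in_cons => /orP[/eqP->|/Qs].
Qed.

Lemma likely_second_moment (m : nat) (K : R) (Z : forall d, T d -> R) :
  (forall d, (m < d)%N -> measurable_fun setT (Z d)) ->
  (forall d, (m < d)%N -> \int[P d]_w (Z d w ^+ 2)%:E <= (K * d%:R)%:E) ->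
  likely (fun C d w => (`|Z d w| <= C * Num.sqrt d%:R)%R).
Proof.
move=> mZ KZ eps eps0.
(* Chebyshev bounds the probability by K / C^2 <= eps; the absolute value and the 1 keep [C]
   positive for every [K]. *)
pose C : R := Num.sqrt (`|K| / eps + 1)%R.
have C1 : (0 < `|K| / eps + 1)%R by rewrite ltr_wpDl// divr_ge0// ltW.
have C0 : (0 < C)%R by rewrite sqrtr_gt0.
exists C, m => d md.
have d0 : (0 < d%:R :> R)%R by rewrite ltr0n (leq_ltn_trans _ md).
rewrite (_ : [set w | _] = [set w | (C * Num.sqrt d%:R < `|Z d w|)%R]); last first.
  by apply/seteqP; split => w /=; [move/negP; rewrite -ltNge|rewrite ltNge => /negP].
apply: le_trans (chebyshev_outer (mZ d md) _ (KZ d md)) _.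
  by rewrite mulr_gt0// sqrtr_gt0.
rewrite lee_fin exprMn !sqr_sqrtr ?(ltW d0) ?(ltW C1)//.
rewrite invfM mulrACA mulfV ?gt_eqF// mulr1 ler_pdivrMr// mulrDr mulr1.
rewrite mulrCA mulfV ?gt_eqF// mulr1.
by apply: le_trans (ler_norm K) _; rewrite lerDl ltW.
Qed.

Lemma likely_bounded X :
  likely (fun C d w => `|X d w| <= C%:E) -> bounded_in_prob P X.
Proof.
move=> lX eps /lX[C [M CM]]; exists C, M => d /CM.
by rewrite /inner_prob EFinB => ?; rewrite leeB.
Qed.

(** A bound [C] on |X| and the event |X| > C would each fail with outer probability at most 1/4, yet
    their failures cover the space. *)
Lemma likely_unbounded X :
  (forall C : R, likely (fun _ d w => C%:E < `|X d w|)) -> unbounded_in_prob P X.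
Proof.
move=> lX bX; have eps0 : (0 < 1 / 4 :> R)%R by rewrite divr_gt0.
have [C [M CM]] := bX _ eps0; have [_ [M' CM']] := lX C _ eps0.
pose d := (maxn M M').+1.
have := CM d; rewrite ltnS leq_maxl => /(_ isT) low.
have := CM' d; rewrite ltnS leq_maxr => /(_ isT) up.
have [] : ~ (1 <= 1 / 4 + 1 / 4 :> R)%R by apply/negP; rewrite -ltNge; lra.
apply: (outer_prob_cover _ _ up (A := ~` [set w | `|X d w| <= C%:E])).
  apply/seteqP; split => // w _ /=.
  by have [h|h] := pselect (`|X d w| <= C%:E); [right; rewrite ltNge h|left].
have fA : outer_prob (P d) (~` [set w | `|X d w| <= C%:E]) \is a fin_num.
  rewrite ge0_fin_numE; last exact: outer_measure_ge0.
  apply: (@le_lt_trans _ _ 1); last exact: ltry.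
  rewrite -(probability_setT (P d)) -outer_probE//; exact: outer_probS.
move: low; rewrite /inner_prob -(fineK fA) -EFinB !lee_fin; lra.
Qed.

(** The event |X| > delta / 2 and the failure of |X| >= delta cover the space, so the former keeps
    outer probability at least 1/2. *)
Lemma likely_not_cvg X (delta : R) : (0 < delta)%R ->
  likely (fun _ d w => delta%:E <= `|X d w|) -> ~ cvg_to_zero_in_prob P X.
Proof.
move=> delta0 lX cX.
have delta2 : (0 < delta / 2)%R by rewrite divr_gt0.
have [_ [M CM]] := lX (1 / 2)%R ltac:(by rewrite divr_gt0).
have := cX _ delta2; set p := (fun d => _) => cp.
suff : (1 / 2)%:E <= limn p by rewrite (cvg_lim _ cp)// lee_fin; lra.
apply: lime_ge; first by apply/cvg_ex; exists 0.
exists M.+1 => // d /= Md; rewrite leNgt; apply/negP => pd.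
have pE : p d = (fine (p d))%:E.
  rewrite fineK// ge0_fin_numE; last exact: outer_measure_ge0.
  by apply: lt_trans pd _; exact: ltry.
have [] : ~ (1 <= fine (p d) + 1 / 2)%R.
  by apply/negP; rewrite -ltNge; move: pd; rewrite pE lte_fin; lra.
apply: (outer_prob_cover _ _ (CM d Md) (A := [set w | (delta / 2)%:E < `|X d w|])).
  apply/seteqP; split => // w _ /=.
  have [h|h] := pselect (delta%:E <= `|X d w|); [left|by right].
  by apply: lt_le_trans h; rewrite lte_fin; lra.
by rewrite -pE.
Qed.

End LikelyEvents.

(** * The original cloud *)

Section OriginalCloud.
Variables (R : realType) (F : fieldType) (n s : nat) (x : 'I_s -> 'I_n -> R).

Lemma cloudP d (pts : 'I_n -> 'rV[R]_d) u :
  reflect (exists i, u = pts i) (u \in cloud pts).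
Proof.
apply: (iffP (imfsetP _ _ _ _)) => [[i _ ->]|[i ->]]; first by exists i.
by exists i.
Qed.

Lemma dot_original d i j : (s <= d)%N ->
  dot (original_point x d i) (original_point x d j) = \sum_k x k i * x k j.
Proof.
move=> sd.
pose f (k : nat) : R := oapp (fun k' : 'I_s => x k' i * x k' j) 0 (insub k).
transitivity (\sum_(k < s) f k); last by apply: eq_bigr => k _; rewrite /f valK.
rewrite (big_ord_widen _ _ sd) [RHS]big_mkcond; apply: eq_bigr => k _.
rewrite !mxE /f; case: ifP => ks; last by rewrite !insubN ?ks//= mul0r.
by rewrite !insubT.
Qed.

Definition original_dist i j : R := Num.sqrt (\sum_k (x k i - x k j) ^+ 2).

Lemma enorm_original d i j : (s <= d)%N ->
  enorm (original_point x d i - original_point x d j) = original_dist i j.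
Proof.
move=> sd; rewrite -[LHS]ger0_norm ?enorm_ge0// -sqrtr_sqr sqr_enormB.
rewrite !dot_original// -big_split/= -sumrMnl -sumrB; congr Num.sqrt.
by apply: eq_bigr => k _; ring.
Qed.

Lemma original_diameter : exists2 M : R, 0 <= M & forall d, (s <= d)%N ->
  forall u v, u \in original_cloud x d -> v \in original_cloud x d ->
  enorm (u - v) <= M.
Proof.
exists (\big[Num.max/0]_p original_dist p.1 p.2).
  exact: bigmax_ge_id.
move=> d sd u v /cloudP[i ->] /cloudP[j ->]; rewrite enorm_original//.
exact: (le_bigmax_cond 0 (fun p => original_dist p.1 p.2) (j := (i, j))).
Qed.

(** Every persistence is half a difference of two distances from a finite list that does not change
    with d. The least positive candidate works; 1 is the default if there is none. *)
Lemma original_gap : exists2 g : R, 0 < g & forall d, (s <= d)%N -> forall N p,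
  (0 < rips_diagram F N (original_cloud x d) p)%N -> g <= p.2 - p.1.
Proof.
pose f (q : ('I_n * 'I_n) * ('I_n * 'I_n)) :=
  original_dist q.2.1 q.2.2 - original_dist q.1.1 q.1.2.
exists (\big[Num.min/1]_(q | 0 < f q) (f q / 2)).
  by apply: lt_bigmin => // q fq; rewrite divr_gt0.
move=> d sd N p /rips_diagram_gt0[lt_p [a [b ab]] [a' [b' ab']]].
have /cloudP[i ai] := fsvalP a; have /cloudP[j bj] := fsvalP b.
have /cloudP[i' ai'] := fsvalP a'; have /cloudP[j' bj'] := fsvalP b'.
have fE : f ((i, j), (i', j')) = 2 * (p.2 - p.1).
  by rewrite /f/= -!(enorm_original _ _ sd) -ai -bj -ai' -bj' -ab -ab' -mulrBr.
rewrite (_ : p.2 - p.1 = f ((i, j), (i', j')) / 2); last by rewrite fE mulrC mulKf.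
by apply: bigmin_le_cond; rewrite fE mulr_gt0// subr_gt0.
Qed.

End OriginalCloud.

(** * Bilinearity of the inner product *)

Section DotFacts.
Variables (R : realType) (d : nat).
Implicit Types u v w : 'rV[R]_d.

Lemma dotC u v : dot u v = dot v u.
Proof. by apply: eq_bigr => k _; rewrite mulrC. Qed.

Lemma dotDl u v w : dot (u + v) w = dot u w + dot v w.
Proof. by rewrite /dot -big_split/=; apply: eq_bigr => k _; rewrite mxE mulrDl. Qed.

Lemma dotDr u v w : dot w (u + v) = dot w u + dot w v.
Proof. by rewrite dotC dotDl !(dotC w). Qed.

Lemma dotDD u v : dot (u + v) (u + v) = dot u u + dot u v *+ 2 + dot v v.
Proof. by rewrite !dotDl !dotDr (dotC v u) mulr2n !addrA. Qed.

Lemma dot_ge0 u : 0 <= dot u u.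
Proof. by apply: sumr_ge0 => k _; rewrite -expr2 sqr_ge0. Qed.

End DotFacts.

(** * Mass of a continuous law away from the origin *)

Section LawFacts.
Variables (R : realType) (mu : probability (measurableTypeR R) R).
Local Open Scope ereal_scope.

(** Otherwise all sets |y| >= 1 / (k + 1) are null and [mu] is concentrated at 0, which is a null
    set too. *)
Lemma continuous_law_away0 : continuous_law mu ->
  exists2 eta : R, (0 < eta)%R & 0 < mu [set y | (eta <= `|y : R|)%R].
Proof.
move=> cmu; apply/not_exists2P => h.
pose A k : set (measurableTypeR R) := [set y | (k.+1%:R^-1 <= `|y : R|)%R].
have mA k : measurable (A k).
  by rewrite -[X in measurable X]setTI; apply: measurable_fun_ler.
have A0 k : mu (A k) = 0.
  apply/eqP; rewrite eq_le measure_ge0 andbT leNgt; apply/negP => Ak.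
  by have [|] := h k.+1%:R^-1%R; apply; rewrite ?invr_gt0.
have Z0 : mu [set 0%R : R] = 0.
  move/null_content_dominatesP: cmu; apply; first exact: measurable_set1.
  exact: lebesgue_measure_set1.
have : mu.-negligible (setT : set (measurableTypeR R)).
  rewrite (_ : setT = [set (0%R : R)] `|` \bigcup_k A k).
    apply: negligibleU.
      by exists [set (0%R : R)]; split => //; exact: measurable_set1.
    apply: negligible_bigcup => k; exists (A k); split; [exact: mA|exact: A0|by []].
  apply/seteqP; split => // y _.
  have [->|y0] := eqVneq (y : R) 0%R; first by left.
  right; exists (Num.bound (`|y : R|^-1)) => //=.
  rewrite /A/= -[leRHS]invrK lef_pV2 ?posrE ?invr_gt0 ?normr_gt0//.
  apply: le_trans (ltW (archi_boundP _)) _; first by rewrite invr_ge0.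
  by rewrite ler_nat.
move=> /(negligibleP mu measurableT) mu0.
have [/eqP] : (1 : \bar R) = 0 by rewrite -(probability_setT mu); exact: mu0.
by rewrite oner_eq0.
Qed.

End LawFacts.

(** * The observed cloud *)

Section ObservedCloud.
Variables (R : realType) (n s : nat) (x : 'I_s -> 'I_n -> R).
Variables (mu : probability (measurableTypeR R) R) (nu : R).
Variables (disp : nat -> measure_display).
Variables (Omega : forall d : nat, measurableType (disp d)).
Variables (Pr : forall d : nat, probability (Omega d) R).
Variable e : forall d : nat, 'I_n -> {RV (Pr d) >-> d.-tuple (measurableTypeR R)}.
Hypothesis sn : (s < n)%N.
Hypothesis nu_gt0 : 0 < nu.
Hypothesis noise : forall d : nat, (n < d)%N -> noise_cloud mu nu (e d).

Definition noise_row d i (w : Omega d) : 'rV[R]_d := \row_k tnth (e d i w) k.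

Local Notation orig := (original_point x).
Local Notation observed d w := (observed_point x (fun i => e d i w)).

Lemma observed_pointE d i w : observed d w i = orig d i + noise_row i w.
Proof. by []. Qed.

Let sd d : (n < d)%N -> (s <= d)%N.
Proof. by move=> nd; rewrite ltnW// (ltn_trans sn). Qed.

Let d_ge1 d : (n < d)%N -> 1 <= d%:R :> R.
Proof. by move=> nd; rewrite ler1n (leq_ltn_trans _ nd). Qed.

Lemma measurable_row (d : nat) i (k : 'I_d) :
  measurable_fun setT (fun w : Omega d => noise_row i w 0 k : R).
Proof.
rewrite (_ : (fun _ => _) = fun w => noise_coord (e d) i k w : R).
  exact: measurable_noise_coordR.
by apply/funext => w; rewrite mxE.
Qed.

(** The second moment nu |x_i|^2 does not grow with d; the coarser scale sqrt d is that of the other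
    cross products. *)
Lemma likely_original_noise i j :
  likely Pr (fun C d w => `|dot (orig d i) (noise_row j w)| <= C * Num.sqrt d%:R).
Proof.
apply: (likely_second_moment (m := n) (K := nu * \sum_k x k i * x k i)) => d nd.
  by apply: measurable_sum => k; apply: measurable_funM => //; exact: measurable_row.
have := noise_linear_moment (noise nd) j (fun k => orig d i 0 k).
under eq_bigr do rewrite expr2.
rewrite -/(dot (orig d i) (orig d i)) dot_original; last exact: sd.
rewrite (_ : (\int[_]_w _)%E = (\int[Pr d]_w (dot (orig d i) (noise_row j w) ^+ 2)%:E)%E).
  move=> ->; rewrite lee_fin ler_peMr ?d_ge1//.
  by rewrite mulr_ge0 ?(ltW nu_gt0)// sumr_ge0// => k _; rewrite -expr2 sqr_ge0.
apply: eq_integral => w _; congr (_ ^+ 2)%:E; apply: eq_bigr => k _.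
by congr (_ * _); rewrite [RHS]mxE.
Qed.

Lemma likely_noise_noise i j : i != j ->
  likely Pr (fun C d w => `|dot (noise_row i w) (noise_row j w)| <= C * Num.sqrt d%:R).
Proof.
move=> ij; apply: (likely_second_moment (m := n) (K := nu ^+ 2)) => d nd.
  by apply: measurable_sum => k; apply: measurable_funM; exact: measurable_row.
rewrite -(noise_bilinear_moment (noise nd) (ltW nu_gt0) ij) le_eqVlt; apply/orP; left.
apply/eqP/eq_integral => w _; congr (_ ^+ 2)%:E; apply: eq_bigr => k _.
by rewrite !mxE.
Qed.

Lemma likely_empirical i (g : R -> R) (v : R) :
  measurable_fun setT g -> (\int[mu]_y (g y)%:E = 0)%E ->
  (\int[mu]_y (g y ^+ 2)%:E = v%:E)%E ->
  likely Pr (fun C d w => `|\sum_k g (noise_row i w 0 k)| <= C * Num.sqrt d%:R).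
Proof.
move=> mg g0 g2; apply: (likely_second_moment (m := n) (K := v)) => d nd.
  by apply: measurable_sum => k; apply: measurableT_comp mg _; exact: measurable_row.
rewrite -(noise_empirical_moment (noise nd) i mg g0 g2) le_eqVlt; apply/orP; left.
apply/eqP/eq_integral => w _; congr (_ ^+ 2)%:E; apply: eq_bigr => k _.
by rewrite mxE.
Qed.

(* Truncation makes the law of large numbers quantitative without any moment
   beyond the variance: only the coordinates that are at least [eta] in absolute
   value are counted. *)
Lemma likely_noise_norm_ge : continuous_law mu ->
  exists2 q : R, 0 < q & forall i,
    likely Pr (fun C d w =>
      q * d%:R - C * Num.sqrt d%:R <= dot (noise_row i w) (noise_row i w)).
Proof.
move=> /continuous_law_away0[eta eta0]; set A := [set y | _] => muA.
have mA : measurable (A : set (measurableTypeR R)).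
  by rewrite -[X in measurable X]setTI; apply: measurable_fun_ler.
pose p : R := fine (mu A).
have muAE : mu A = p%:E by rewrite fineK// fin_num_measure.
have p0 : 0 < p by rewrite -lte_fin -muAE.
pose g (y : R) : R := \1_A y - p.
have mg : measurable_fun setT g.
  by apply: measurable_funB => //; exact: measurable_indic.
have p1 : p <= 1 by rewrite -lee_fin -muAE probability_le1.
have gA : (\int[mu]_y (\1_A y : R)%:E = p%:E)%E.
  by rewrite integral_indic// setIT.
have g0 : (\int[mu]_y (g y)%:E = 0)%E.
  under eq_integral do rewrite EFinB.
  rewrite integralB//=; last 2 first.
  - exact: integrable_indic.
  - exact: finite_measure_integrable_cst.
  rewrite gA integral_cst//= probability_setT mule1 subee//.
have g2 : (\int[mu]_y (g y ^+ 2)%:E < +oo)%E.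
  apply: (@le_lt_trans _ _ (\int[mu]_y (cst 1%:E) y)%E).
    apply: ge0_le_integral => //.
    - by move=> y _; rewrite lee_fin sqr_ge0.
    - by apply/measurable_EFinP; exact: measurable_funX.
    - move=> y _; rewrite lee_fin /g indicE; case: (y \in A) => /=; nra.
  by rewrite integral_cst//= probability_setT mule1 ltry.
have g2E : (\int[mu]_y (g y ^+ 2)%:E = (fine (\int[mu]_y (g y ^+ 2)%:E))%:E)%E.
  by rewrite fineK// ge0_fin_numE// integral_ge0// => y _; rewrite lee_fin sqr_ge0.
exists (eta ^+ 2 * p); first by rewrite mulr_gt0// exprn_gt0.
move=> i; apply: likely_sub (likely_empirical i mg g0 g2E) => C.
exists (eta ^+ 2 * C), 0%N => d w _; rewrite ler_norml => /andP[+ _].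
rewrite /g sumrB big_const_ord iter_addr_0 -[p *+ d]mulr_natr => count_ge.
apply: (@le_trans _ _ (eta ^+ 2 * \sum_k \1_A (noise_row i w 0 k))).
  rewrite -(mulrA _ p) -(mulrA _ C) -mulrBr ler_pM2l ?exprn_gt0//; lra.
(* Termwise y^2 >= eta^2 1_A(y). *)
rewrite mulr_sumr; apply: ler_sum => k _; rewrite indicE.
case: (boolP (_ \in A)) => [|_]; last by rewrite mulr0 -expr2 sqr_ge0.
rewrite inE /A/= mulr1 -expr2 => eta_le.
by rewrite -[leRHS]real_normK ?num_real// ler_sqr ?nnegrE// ltW.
Qed.

Lemma likely_noise_norm : finite_fourth_moment mu -> forall i,
  likely Pr (fun C d w =>
    `|dot (noise_row i w) (noise_row i w) - nu * d%:R| <= C * Num.sqrt d%:R).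
Proof.
move=> mu4 i.
have m2 : measurable_fun setT (fun y : R => y ^+ 2) by exact: measurable_funX.
have m4 : measurable_fun setT (fun y : R => (y ^+ 4)%:E).
  by apply/measurable_EFinP; exact: measurable_funX.
pose g (y : R) : R := y ^+ 2 - nu.
have mg : measurable_fun setT g by exact: measurable_funB.
(* The second moment of [mu] is read off from one coordinate in dimension n + 1, the first one where
   the noise is specified. *)
have nn : (n < n.+1)%N by [].
have e2 : (\int[mu]_y ((y : R) ^+ 2)%:E = nu%:E)%E.
  have := noise_covariance (noise nn) i ord0 ord0; rewrite eqxx => <-.
  rewrite -(noise_integral_ge0 (noise nn) i ord0 (f := fun y => ((y : R) ^+ 2)%:E)).
  - by apply: eq_integral => w _; rewrite expr2.
  - exact/measurable_EFinP.
  - by move=> y; rewrite lee_fin sqr_ge0.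
have i2 : mu.-integrable setT (fun y : R => (y ^+ 2)%:E).
  apply/integrableP; split; first exact/measurable_EFinP.
  apply: (@le_lt_trans _ _ nu%:E); last exact: ltry.
  rewrite -e2 le_eqVlt; apply/orP; left; apply/eqP/eq_integral => y _.
  by rewrite gee0_abs// lee_fin sqr_ge0.
have ic : mu.-integrable setT (cst nu%:E) by exact: finite_measure_integrable_cst.
have g0 : (\int[mu]_y (g y)%:E = 0)%E.
  under eq_integral do rewrite EFinB.
  rewrite (integralB measurableT i2 ic) e2 integral_cst//=.
  by rewrite probability_setT mule1 subee.
have i4 : mu.-integrable setT (fun y : R => (y ^+ 4)%:E).
  apply/integrableP; split => //; apply: le_lt_trans mu4.
  rewrite le_eqVlt; apply/orP; left; apply/eqP/eq_integral => y _.
  by rewrite gee0_abs// lee_fin (exprM _ 2 2) sqr_ge0.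
have ic2 : mu.-integrable setT (cst (nu ^+ 2)%:E) by exact: finite_measure_integrable_cst.
have g2 : (\int[mu]_y (g y ^+ 2)%:E < +oo)%E.
  have /integrableP[_] := integrableD measurableT i4 ic2.
  apply: le_lt_trans; apply: ge0_le_integral => //.
  - by move=> y _; rewrite lee_fin sqr_ge0.
  - by apply/measurable_EFinP; exact: measurable_funX.
  - by apply: measurableT_comp => //; exact: emeasurable_funD.
  (* (y^2 - nu)^2 <= y^4 + nu^2, as the cross term is nonpositive. *)
  - move=> y _ /=; rewrite lee_fin ger0_norm.
      rewrite /g (exprM _ 2 2); have := sqr_ge0 y; move: (y ^+ 2) => z.
      have := nu_gt0; nra.
    by rewrite addr_ge0 ?sqr_ge0// (exprM _ 2 2) sqr_ge0.
have g2E : (\int[mu]_y (g y ^+ 2)%:E = (fine (\int[mu]_y (g y ^+ 2)%:E))%:E)%E.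
  by rewrite fineK// ge0_fin_numE// integral_ge0// => y _; rewrite lee_fin sqr_ge0.
apply: likely_sub (likely_empirical i mg g0 g2E) => C; exists C, 0%N => d w _.
rewrite /g sumrB big_const_ord iter_addr_0 -[nu *+ d]mulr_natr.
by under eq_bigr do rewrite expr2.
Qed.

Lemma original_dot_bounded : exists2 K : R, 0 <= K &
  forall d, (n < d)%N -> forall i j, `|dot (orig d i) (orig d j)| <= K * Num.sqrt d%:R.
Proof.
pose f (p : 'I_n * 'I_n) := `|\sum_k x k p.1 * x k p.2|.
have K0 : 0 <= \big[Num.max/0]_p f p.
  exact: bigmax_ge_id.
exists (\big[Num.max/0]_p f p) => // d nd i j; rewrite dot_original; last exact: sd.
apply: (@le_trans _ _ (\big[Num.max/0]_p f p)).
  exact: (le_bigmax_cond 0 f (j := (i, j))).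
by rewrite ler_peMr// -[leLHS](sqrtr1 R) ler_wsqrtr ?d_ge1.
Qed.

Lemma likely_cross_products : likely Pr (fun C d w => forall i j,
  `|dot (orig d i) (noise_row j w)| <= C * Num.sqrt d%:R /\
  (i != j -> `|dot (observed d w i) (observed d w j)| <= C * Num.sqrt d%:R)).
Proof.
pose Q (i j : 'I_n) (C : R) d (w : Omega d) :=
  `|dot (orig d i) (noise_row j w)| <= C * Num.sqrt d%:R /\
  (i != j -> `|dot (noise_row i w) (noise_row j w)| <= C * Num.sqrt d%:R).
have mono (C C' : R) d : C <= C' -> C * Num.sqrt d%:R <= C' * Num.sqrt d%:R :> R.
  by move=> CC'; rewrite ler_wpM2r// sqrtr_ge0.
have mQ i j : monotone_in_bound (Q i j).
  move=> C C' d w CC' [h1 h2]; split; first exact: le_trans h1 (mono _ _ _ CC').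
  by move=> /h2 h; exact: le_trans h (mono _ _ _ CC').
have lQ i j : likely Pr (Q i j).
  apply: likely_and; last 2 first.
  - exact: likely_original_noise.
  - have [ij|ij] := boolP (i != j); last exact: likely_always.
    by apply: likely_sub (likely_noise_noise ij) => C; exists C, 0%N.
  - by move=> C C' d w CC' h; exact: le_trans h (mono _ _ _ CC').
  - by move=> C C' d w CC' h /h h'; exact: le_trans h' (mono _ _ _ CC').
have [K K0 origK] := original_dot_bounded.
have := @likely_forall _ _ _ Pr _ (fun p : 'I_n * 'I_n => Q p.1 p.2)
  (fun p => mQ p.1 p.2) (fun p => lQ p.1 p.2).
(* Three products involving noise and one of original points. *)
apply: likely_sub => C; exists (`|C| * 3 + K), n => d w nd QC i j.
have r0 : 0 <= Num.sqrt d%:R :> R by exact: sqrtr_ge0.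
have Cr := ler_wpM2r r0 (ler_norm C).
have Cr0 : 0 <= `|C| * Num.sqrt d%:R by rewrite mulr_ge0.
have Kr0 : 0 <= K * Num.sqrt d%:R by rewrite mulr_ge0.
have [/= h1 h2] := QC (i, j); have [/= h3 _] := QC (j, i).
split; first by lra.
move=> /h2 {}h2; rewrite !observed_pointE !dotDl !dotDr (dotC (noise_row i w) (orig d j)).
move: (origK d nd i j) h1 h2 h3; rewrite !ler_norml.
move=> /andP[? ?] /andP[? ?] /andP[? ?] /andP[? ?].
by apply/andP; split; lra.
Qed.

Lemma likely_geometry : continuous_law mu -> exists2 c : R, 0 < c &
  likely Pr (fun C d w => forall i j, i != j ->
    c * Num.sqrt d%:R <= enorm (observed d w i - observed d w j) /\
    `|dot (observed d w i) (observed d w j)| <= C * Num.sqrt d%:R).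
Proof.
move=> /likely_noise_norm_ge[q q0 lq]; exists (Num.sqrt q); first by rewrite sqrtr_gt0.
have mono (C C' : R) d : C <= C' -> C * Num.sqrt d%:R <= C' * Num.sqrt d%:R :> R.
  by move=> CC'; rewrite ler_wpM2r// sqrtr_ge0.
have mlq i : monotone_in_bound (fun (C : R) d (w : Omega d) =>
    q * d%:R - C * Num.sqrt d%:R <= dot (noise_row i w) (noise_row i w)).
  by move=> C C' d w /(mono _ _ d) CC'; apply: le_trans; rewrite lerD2l lerN2.
have mcross : monotone_in_bound (fun (C : R) d (w : Omega d) => forall i j,
    `|dot (orig d i) (noise_row j w)| <= C * Num.sqrt d%:R /\
    (i != j -> `|dot (observed d w i) (observed d w j)| <= C * Num.sqrt d%:R)).
  move=> C C' d w /(mono _ _ d) CC' h i j; have [h1 h2] := h i j.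
  by split=> [|/h2 h3]; [exact: le_trans h1 CC'|exact: le_trans h3 CC'].
have := likely_and mcross _ likely_cross_products (likely_forall mlq lq).
have mall : monotone_in_bound (fun (C : R) d (w : Omega d) => forall i,
    q * d%:R - C * Num.sqrt d%:R <= dot (noise_row i w) (noise_row i w)).
  by move=> C C' d w CC' h i; exact: mlq CC' (h i).
move=> /(_ mall); apply: likely_sub => C.
(* Up to errors |y_i - y_j|^2 is at least 2 q d. Each squared norm loses 3 |C| sqrt d and the
   doubled cross product 2 |C| sqrt d, in total 8 |C| sqrt d, which is at most q d once sqrt d >=
   B. *)
pose B := (`|C| * 8) / q.
exists C, (maxn n (Num.bound (B ^+ 2))) => d w; rewrite gtn_max.
move=> /andP[nd Bd] [cross norm] i j ij.
have [_ /(_ ij) dotC_le] := cross i j; split => //.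
have r0 : 0 <= Num.sqrt d%:R :> R by exact: sqrtr_ge0.
have rr : Num.sqrt d%:R ^+ 2 = d%:R :> R by rewrite sqr_sqrtr.
have B0 : 0 <= B by rewrite divr_ge0 ?mulr_ge0// ltW.
have Br : B <= Num.sqrt d%:R.
  rewrite -ler_sqr ?nnegrE// rr; apply: (le_trans (ltW (archi_boundP (sqr_ge0 B)))).
  by rewrite ler_nat ltnW.
rewrite -ler_sqr ?nnegrE ?enorm_ge0 ?mulr_ge0 ?sqrtr_ge0// exprMn rr sqr_sqrtr ?(ltW q0)//.
rewrite sqr_enormB {1 2}observed_pointE {1 2}observed_pointE !dotDD.
have Cr := ler_wpM2r r0 (ler_norm C).
have qB : `|C| * 8 <= q * Num.sqrt d%:R by rewrite -ler_pdivrMl// mulrC.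
have := ler_wpM2r r0 qB; rewrite -(mulrA q) -expr2 rr => qBr.
have [+ _] := cross i i; have [+ _] := cross j j.
have := dot_ge0 (orig d i); have := dot_ge0 (orig d j).
have := norm i; have := norm j; move: dotC_le; rewrite !ler_norml.
move=> /andP[? ?] ? ? ? ? /andP[? ?] /andP[? ?].
have : 0 <= `|C| * Num.sqrt d%:R by rewrite mulr_ge0.
lra.
Qed.

Lemma likely_distance : continuous_law mu -> finite_fourth_moment mu ->
  likely Pr (fun C d w => forall i j, i != j ->
    `|enorm (observed d w i - observed d w j) - Num.sqrt (2 * nu * d%:R)| <= C).
Proof.
move=> cmu mu4.
have mono (C C' : R) d : C <= C' -> C * Num.sqrt d%:R <= C' * Num.sqrt d%:R :> R.
  by move=> CC'; rewrite ler_wpM2r// sqrtr_ge0.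
have mnorm i : monotone_in_bound (fun (C : R) d (w : Omega d) =>
    `|dot (noise_row i w) (noise_row i w) - nu * d%:R| <= C * Num.sqrt d%:R).
  by move=> C C' d w /(mono _ _ d) CC' h; exact: le_trans h CC'.
have mcross : monotone_in_bound (fun (C : R) d (w : Omega d) => forall i j,
    `|dot (orig d i) (noise_row j w)| <= C * Num.sqrt d%:R /\
    (i != j -> `|dot (observed d w i) (observed d w j)| <= C * Num.sqrt d%:R)).
  move=> C C' d w /(mono _ _ d) CC' h i j; have [h1 h2] := h i j.
  by split=> [|/h2 h3]; [exact: le_trans h1 CC'|exact: le_trans h3 CC'].
have mall : monotone_in_bound (fun (C : R) d (w : Omega d) => forall i,
    `|dot (noise_row i w) (noise_row i w) - nu * d%:R| <= C * Num.sqrt d%:R).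
  by move=> C C' d w CC' h i; exact: mnorm CC' (h i).
have := likely_and mcross mall likely_cross_products
  (likely_forall mnorm (likely_noise_norm mu4)).
have [K K0 origK] := original_dot_bounded.
(* The numerator collects the errors of |y_i - y_j|^2 around 2 nu d: K + 3 C from each norm and 2 C
   from the cross product, times sqrt d. Factoring the difference of squares and dividing by the sum
   of the roots, at least sqrt (2 nu d), removes sqrt d. *)
apply: likely_sub => C; exists ((8 * C + 2 * K) / Num.sqrt (2 * nu)), n.
move=> d w nd [cross norm] i j ij.
have r0 : 0 < Num.sqrt d%:R :> R by rewrite sqrtr_gt0 (lt_le_trans _ (d_ge1 nd)).
have rr : Num.sqrt d%:R ^+ 2 = d%:R :> R by rewrite sqr_sqrtr.
have nu2 : 0 < 2 * nu by rewrite mulr_gt0.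
have s0 : 0 < Num.sqrt (2 * nu) by rewrite sqrtr_gt0.
rewrite sqrtrM ?(ltW nu2)//; set S := Num.sqrt (2 * nu); set r := Num.sqrt d%:R.
have SS : S ^+ 2 = 2 * nu by rewrite sqr_sqrtr// ltW.
have : `|enorm (observed d w i - observed d w j) ^+ 2 - (S * r) ^+ 2| <=
    (8 * C + 2 * K) * r.
  rewrite exprMn SS rr sqr_enormB {1 2}observed_pointE {1 2}observed_pointE !dotDD.
  have [+ /(_ ij)] := cross i j; have [+ _] := cross i i; have [+ _] := cross j j.
  have := origK d nd i i; have := origK d nd j j.
  have := norm i; have := norm j; rewrite !ler_norml -/r.
  move=> /andP[? ?] /andP[? ?] /andP[? ?] /andP[? ?].
  move=> /andP[? ?] /andP[? ?] /andP[? ?] /andP[? ?].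
  by apply/andP; split; lra.
move: (enorm_ge0 (observed d w i - observed d w j)); set E := enorm _ => E0.
rewrite subr_sqr normrM (ger0_norm (_ : 0 <= E + S * r)) ?addr_ge0 ?mulr_ge0 ?(ltW s0) ?(ltW r0)//.
move=> h; rewrite ler_pdivlMr// -(ler_pM2r r0) -mulrA; apply: le_trans h.
by rewrite ler_wpM2l// lerDr.
Qed.

End ObservedCloud.

(** * From point clouds to distances of their diagrams *)

Section CloudDistances.
Variables (R : realType) (F : fieldType).

Lemma bottleneck_rips_le d N (X Y : {fset 'rV[R]_d}) (c : R) : 0 <= c ->
  (forall p, (0 < rips_diagram F N X p)%N -> p.2 - p.1 <= c *+ 2) ->
  (forall p, (0 < rips_diagram F N Y p)%N -> p.2 - p.1 <= c *+ 2) ->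
  (bottleneck (rips_diagram F N X) (rips_diagram F N Y) <= c%:E)%E.
Proof.
move=> c0 Xc Yc; apply: bottleneck_le => //; try exact: finite_rips_diagram.
  by move=> p Xp; have [lt_p _ _] := rips_diagram_gt0 Xp; rewrite lt_p (birth_ge0 Xp) Xc.
by move=> p Yp; have [lt_p _ _] := rips_diagram_gt0 Yp; rewrite lt_p (birth_ge0 Yp) Yc.
Qed.

(** Distinct points have distinct indices; equal points with different indices merge in the
    cloud. *)
Lemma cloud_pairwise n d (pts : 'I_n -> 'rV[R]_d) (Q : 'rV[R]_d -> 'rV[R]_d -> Prop) :
  (forall i j, i != j -> Q (pts i) (pts j)) ->
  forall u v, u \in cloud pts -> v \in cloud pts -> u != v -> Q u v.
Proof.
move=> Qij u v /cloudP[i ->] /cloudP[j ->] ij; apply: Qij.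
by apply: contra ij => /eqP->.
Qed.

Lemma sqrt_natr_large (K : R) :
  exists M : nat, forall d, (M < d)%N -> K <= Num.sqrt d%:R.
Proof.
exists (Num.bound (K ^+ 2)) => d Md; apply: le_trans (ler_norm K) _.
rewrite -sqrtr_sqr ler_wsqrtr//.
by apply: le_trans (ltW (archi_boundP (sqr_ge0 K))) _; rewrite ler_nat ltnW.
Qed.

End CloudDistances.

Theorem mainTheorem1 (R : realType) (F : fieldType) (n s : nat)
    (hn : (3 < n)%N) (hs : (1 <= s < n)%N) (x : 'I_s -> 'I_n -> R)
    (mu : probability (measurableTypeR R) R) (hmu : continuous_law mu)
    (nu : R) (hnu : 0 < nu)
    (disp : nat -> measure_display)
    (Omega : forall d : nat, measurableType (disp d))
    (Pr : forall d : nat, probability (Omega d) R)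
    (e : forall d : nat, 'I_n -> {RV (Pr d) >-> d.-tuple (measurableTypeR R)})
    (he : forall d : nat, (n < d)%N -> noise_cloud mu nu (e d))
    (N : nat) (hN : (N <= n - 2)%N) :
  let D (d : nat) : R * R -> nat :=
    rips_diagram F N (original_cloud x d) in
  let D' (d : nat) (w : Omega d) : R * R -> nat :=
    rips_diagram F N (observed_cloud x (fun i => e d i w)) in
  let dB (d : nat) (w : Omega d) : \bar R := bottleneck (D d) (D' d w) in
  let dH (d : nat) (w : Omega d) : \bar R :=
    hausdorff (support_set (D d)) (support_set (D' d w)) in
  [/\ N = 0%N -> finite_fourth_moment mu ->
        bounded_in_prob Pr
          (fun d w => (dB d w - (Num.sqrt (2 * nu * d%:R) / 4)%:E)%E),
      (0 < N)%N -> bounded_in_prob Pr dB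
    & (forall d : nat, (n < d)%N -> support_set (D d) !=set0) ->
        ~ cvg_to_zero_in_prob Pr dB /\ unbounded_in_prob Pr dH].
Proof.
move=> D D' dB dH; have /andP[_ sn] := hs.
have sd d : (n < d)%N -> (s <= d)%N by move=> nd; rewrite ltnW// (ltn_trans sn).
have [M0 M0_ge0 diam] := original_diameter x.
have death_D d p : (n < d)%N -> (0 < D d p)%N -> p.2 <= M0 / 2.
  by move=> nd Dp; apply: death_le Dp (diam d (sd d nd)).
have [c c0 geo] := likely_geometry x sn hnu he hmu.
split.
- move=> N0 mu4; rewrite N0 in D D' dB dH death_D *; apply: likely_bounded.
  apply: likely_sub (likely_distance x sn hnu he hmu mu4) => C.
  have [M rM] := sqrt_natr_large ((`|C| + 1) / Num.sqrt (2 * nu)).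
  exists (`|C| + M0), (maxn n M) => d w; rewrite gtn_max => /andP[nd Md] near_S.
  move: near_S; set S := Num.sqrt (2 * nu * d%:R) => near_S.
  have nu2 : 0 < 2 * nu by rewrite mulr_gt0.
  (* Forces points with different indices to be distinct, so that the observed diagram in degree 0
     is not empty. *)
  have CS : `|C| + 1 <= S.
    rewrite /S sqrtrM ?(ltW nu2)// mulrC -ler_pdivrMr ?sqrtr_gt0//.
    exact: rM.
  have C_ge := ler_norm C.
  have near_Y := cloud_pairwise (Q := fun u v => `|enorm (u - v) - S| <= C) near_S.
  (* Everything is matched with the diagonal; deaths are at most M0 / 2 for P and (S + |C|) / 2 for
     P'. *)
  have upper : (dB d w <= ((S + `|C| + M0) / 4)%:E)%E.
    apply: bottleneck_rips_le => [|p Dp|p D'p].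
    + by have := normr_ge0 C; lra.
    + have := death_D _ _ nd Dp; have := birth_ge0 Dp; have := normr_ge0 C; lra.
    + have := birth_ge0 D'p; suff : p.2 <= (S + `|C|) / 2 by lra.
      apply: death_le D'p _ => u v uY vY; have [<-|uv] := eqVneq u v.
        by rewrite subrr enorm0; have := normr_ge0 C; lra.
      by have := near_Y u v uY vY uv; rewrite ler_norml => /andP[]; lra.
  (* A point (0, t) of the observed diagram with t >= (S - |C|) / 2 is t / 2 away from the diagonal
     and at least t - M0 / 2 away from D_0(P). *)
  have lower : ((S / 4 - `|C| - M0)%:E <= dB d w)%E.
    pose i0 : 'I_n := Ordinal (ltn_trans (ltn0Sn 2) hn).
    pose i1 : 'I_n := Ordinal (ltn_trans (ltnSn 1) (ltnW hn)).
    pose Y := observed_point x (fun i => e d i w).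
    have Y01 : Y i0 != Y i1.
      have := near_S i0 i1 isT; rewrite -/(Y i0) -/(Y i1) => near01.
      apply/eqP => Y01; move: near01; rewrite Y01 subrr enorm0.
      by rewrite sub0r normrN ler_norml => /andP[]; lra.
    have YP i : Y i \in observed_cloud x (fun i => e d i w) by apply/cloudP; exists i.
    have [t D't] := rips_diagram0_nonempty F (YP i0) (YP i1) Y01.
    have t_ge : (S - `|C|) / 2 <= t.
      apply: (death_ge D't) => u v uY vY uv.
      by have := near_Y u v uY vY uv; rewrite ler_norml => /andP[]; lra.
    apply: (bottleneck_ge_right D't) => [q Dq|/=].
      apply: le_trans (normB_snd _ _); have := death_D _ _ nd Dq => /=.
      by have := normr_ge0 C; lra.
    by have := normr_ge0 C; lra.
  change (`|dB d w - (S / 4)%:E| <= (`|C| + M0)%:E)%E.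
  move: lower upper; case: (dB d w) => [b| |]//; rewrite !lee_fin => lower upper.
  have C0 := normr_ge0 C; rewrite ler_norml; apply/andP; split; lra.
- move=> N0; apply: likely_bounded; apply: likely_sub geo => C.
  exists (`|C| / c + M0), n => d w nd geoC.
  rewrite gee0_abs ?bottleneck_ge0//.
  have Cc0 : 0 <= `|C| / c by rewrite divr_ge0// ltW.
  apply: bottleneck_rips_le => [|p Dp|p D'p]; first by rewrite addr_ge0.
    by have := death_D _ _ nd Dp; have := birth_ge0 Dp; lra.
  have r0 : 0 < Num.sqrt d%:R :> R by rewrite sqrtr_gt0 ltr0n (leq_ltn_trans _ nd).
  have p2 : c * Num.sqrt d%:R / 2 <= p.2.
    apply: (death_ge D'p); apply: cloud_pairwise => i j ij.
    by have [] := geoC i j ij.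
  have p2p1 : p.2 ^+ 2 <= p.1 ^+ 2 + C * Num.sqrt d%:R.
    apply: (rips_diagram_shrink N0 _ D'p); apply: cloud_pairwise => i j ij.
    by have [] := geoC i j ij.
  have p1 := birth_ge0 D'p; have [lt_p _ _] := rips_diagram_gt0 D'p.
  suff : p.2 - p.1 <= `|C| / c *+ 2 by lra.
  rewrite -mulrnAl ler_pdivlMr// -(ler_pM2r r0).
  have Cr := ler_wpM2r (ltW r0) (ler_norm C).
  (* The product on the right is p.2^2 - p.1^2 <= C sqrt d; cancelling sqrt d bounds the persistence
     by 2 |C| / c. *)
  have : (p.2 - p.1) * (c * Num.sqrt d%:R / 2) <= (p.2 - p.1) * (p.2 + p.1).
    by rewrite ler_wpM2l ?subr_ge0 ?(ltW lt_p)//; lra.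
  by rewrite -subr_sqr; lra.
- move=> nonempty; have [g g0 gap] := original_gap F x.
  (* Deaths of P stay below M0 / 2 while those of P' exceed c sqrt d / 2. *)
  have far (K : R) : exists M, forall d w, (M < d)%N ->
      (forall i j, i != j -> c * Num.sqrt d%:R <= enorm
        (observed_point x (fun i => e d i w) i - observed_point x (fun i => e d i w) j)) ->
      forall p, (0 < D d p)%N -> forall q, (0 < D' d w q)%N -> K <= `|p - q|.
    have [M rM] := sqrt_natr_large ((K * 2 + M0) / c).
    exists (maxn n M) => d w; rewrite gtn_max => /andP[nd Md] geoc p Dp q D'q.
    have q2 : c * Num.sqrt d%:R / 2 <= q.2.
      by apply: (death_ge D'q); exact: cloud_pairwise.
    have := rM d Md; rewrite ler_pdivrMr// => Kr.
    rewrite distrC; apply: le_trans (normB_snd _ _).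
    by have := death_D _ _ nd Dp; lra.
  split.
    (* A point of D_N(P) goes to the diagonal at cost at least g / 2, or to a point of D_N(P') at
       cost at least 1 for large d. *)
    apply: (likely_not_cvg (delta := Num.min (g / 2) 1)).
      by rewrite lt_min divr_gt0//=.
    apply: likely_sub geo => C; have [M farM] := far 1.
    exists 0, (maxn n M) => d w; rewrite gtn_max => /andP[nd Md] geoC.
    have [p Dp] := nonempty d nd.
    rewrite gee0_abs ?bottleneck_ge0//; apply: (bottleneck_ge_left Dp) => [q D'q|].
      apply: (@le_trans _ _ 1); first by rewrite ge_min lexx orbT.
      by apply: (farM d w Md _ p Dp q D'q) => i j ij; have [] := geoC i j ij.
    have := gap d (sd d nd) N p Dp.
    have : Num.min (g / 2) 1 <= g / 2 by rewrite ge_min lexx.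
    lra.
  apply: likely_unbounded => K; apply: likely_sub geo => C.
  (* The extra 1 makes the inequality strict. *)
  have [M farM] := far (K + 1).
  exists 0, (maxn n M) => d w; rewrite gtn_max => /andP[nd Md] geoC.
  have [p Dp] := nonempty d nd.
  apply: (@lt_le_trans _ _ (K + 1)%:E); first by rewrite lte_fin ltrDl.
  apply: le_trans (lee_abs _); apply: (hausdorff_ge (p := p)) => // q D'q.
  by apply: (farM d w Md _ p Dp q D'q) => i j ij; have [] := geoC i j ij.
Qed.
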